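(* Let $n\ge 3$ and $\mathbb{R}^n_+=\{x : x_n>0\}$. Let $u=(u_1,\dots,u_n)$ be the velocity of a solution to the Navier–Stokes equations $$\partial_t u+(u\cdot\nabla)u-\mu\,\Delta u+\nabla\pi=0,\qquad \nabla\cdot u=0\quad\text{in }\mathbb{R}^n_+\times(0,T],\qquad u(x,0)=u_0(x)\quad\text{in }\mathbb{R}^n_+,$$ under the slip boundary conditions $$u_n=0,\qquad \partial_n u_j=0\quad(1\le j\le n-1)$$ on the boundary $\{x : x_n=0\}$. Then $$\Big|\int_{\mathbb{R}^n_+}\nabla[(u\cdot\nabla)u]\cdot\nabla u\,dx\Big|\le c(n)\int_{\mathbb{R}^n_+}|\overline{u}|\,|\nabla u|\,|\nabla^2u|\,dx,$$ where $\overline{u}=(u_1,\dots,u_{n-1},0)$ is the component of the velocity parallel to the boundary.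
   Context: The unknowns are the velocity $u$ and the scalar pressure $\pi$; $u_0$ is the initial velocity and $\mu>0$ is the constant viscosity. $c(n)$ denotes a constant depending on the dimension $n$. $\partial_t$ denotes the time derivative, $\partial_k=\partial/\partial x_k$, $(u\cdot\nabla)u_j=\sum_{i=1}^n u_i\,\partial_i u_j$, and $$\nabla[(u\cdot\nabla)u]\cdot\nabla u=\sum_{j,k=1}^n \partial_k\big((u\cdot\nabla)u_j\big)\,\partial_k u_j.$$ Moreover $|\nabla u|^2=\sum_{j,k}(\partial_k u_j)^2$ and $|\nabla^2u|^2=\sum_{i,j,k}(\partial_i\partial_k u_j)^2$. The integrals are over the space variable.
   Formalization: Solutions are classical (C² inside, C¹ up to the boundary), and at the time considered |u||∇u|² and the left-hand integrand are assumed integrable; without decay the claim fails, e.g. n=3, u=(x₁,x₂,−2x₃), where the right side is 0 and the left integral diverges. *)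

(* Defs.v *)
From HB Require Import structures.
From mathcomp Require Import all_boot all_order all_algebra.
From mathcomp Require Import all_classical all_reals all_analysis.

Set Implicit Arguments.
Unset Strict Implicit.
Unset Printing Implicit Defensive.

Import Order.TTheory GRing.Theory Num.Theory.
Import numFieldNormedType.Exports.

Local Open Scope classical_set_scope.
Local Open Scope ring_scope.

(* Lebesgue measure on n-tuples of reals, for the product sigma-algebra:
   the image of the product of the one-dimensional Lebesgue measure and of
   the Lebesgue measure on (n-1)-tuples under (x, t) |-> x :: t. *)
Section lebesgue_tuple.
Context {R : realType}.

Section lebesgue_cons.
Variables (n : nat)
  (mu : {sigma_finite_measure set (n.-tuple (measurableTypeR R)) -> \bar R}).

Let T : measurableType _ := measurableTypeR R.

Definition tuple_cons (p : T * n.-tuple T) : n.+1.-tuple T :=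
  [tuple of p.1 :: p.2].

Lemma measurable_tuple_cons : measurable_fun setT tuple_cons.
Proof.
by apply: measurable_cons; [exact: measurable_fst|exact: measurable_snd].
Qed.

Definition lebesgue_cons : set (n.+1.-tuple T) -> \bar R :=
  pushforward ((@lebesgue_measure R) \x mu)%E tuple_cons.

Let lc0 : lebesgue_cons set0 = 0%E.
Proof. by rewrite /lebesgue_cons /pushforward preimage_set0 measure0. Qed.

Let lc_ge0 A : (0 <= lebesgue_cons A)%E.
Proof. by rewrite /lebesgue_cons /pushforward measure_ge0. Qed.

Let lc_sigma_additive : semi_sigma_additive lebesgue_cons.
Proof.
move=> F mF tF mUF; rewrite /lebesgue_cons /pushforward preimage_bigcup.
apply: measure_semi_sigma_additive.
- by move=> k; rewrite -[X in measurable X]setTI; exact: measurable_tuple_cons.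
- apply/trivIsetP => /= i j _ _ ij; rewrite -preimage_setI.
  by move/trivIsetP : tF => /(_ _ _ _ _ ij) ->//; rewrite preimage_set0.
- rewrite -preimage_bigcup -[X in measurable X]setTI.
  exact: measurable_tuple_cons.
Qed.

HB.instance Definition _ := isMeasure.Build _ _ _ lebesgue_cons
  lc0 lc_ge0 lc_sigma_additive.

Let lc_sigma_finite : sigma_finite setT lebesgue_cons.
Proof.
have /sigma_finiteP[F [TF ndF Foo]] := sigma_finiteT (@lebesgue_measure R).
have /sigma_finiteP[G [TG ndG Goo]] := sigma_finiteT mu.
pose g (t : n.+1.-tuple T) : T * n.-tuple T := (thead t, [tuple of behead t]).
have mg : measurable_fun setT g.
  apply: measurable_fun_pair => /=; last exact: measurable_behead.
  exact: measurable_tnth.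
have gK : cancel tuple_cons g.
  by case=> x t; congr pair; apply/val_inj.
exists (fun k => g @^-1` (F k `*` G k)).
  apply/esym; rewrite -subTset => t _.
  have [i _ Fi] : (\bigcup_i F i) (g t).1 by rewrite -TF.
  have [j _ Gj] : (\bigcup_i G i) (g t).2 by rewrite -TG.
  exists (maxn i j) => //; split.
  - by move: Fi; exact/subsetPset/ndF/leq_maxl.
  - by move: Gj; exact/subsetPset/ndG/leq_maxr.
move=> k; have [mF Fk] := Foo k; have [mG Gk] := Goo k; split.
  by rewrite -[X in measurable X]setTI; apply: mg => //; exact: measurableX.
rewrite /lebesgue_cons /pushforward -comp_preimage.
rewrite (_ : g \o tuple_cons = id); last by rewrite funeqE => x /=; rewrite gK.
by rewrite preimage_id product_measure1E// lte_mul_pinfty// ge0_fin_numE.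
Qed.

HB.instance Definition _ := @Measure_isSigmaFinite.Build _ _ _ lebesgue_cons
  lc_sigma_finite.
End lebesgue_cons.

Fixpoint lebesgue_tuple (n : nat) :
    {sigma_finite_measure set (n.-tuple (measurableTypeR R)) -> \bar R} :=
  match n with
  | 0 => \d_[tuple]
  | m.+1 => lebesgue_cons (lebesgue_tuple m)
  end.

End lebesgue_tuple.

Section half_space.
Context {R : realType} {n : nat}.

(* The dimension of the space is n.+1 throughout, so that the normal coordinate
   is the one with index ord_max. *)
Local Notation V := 'rV[R]_n.+1.

Definition half_space : set V := [set x | 0 < x 0 ord_max].
Definition closed_half_space : set V := [set x | 0 <= x 0 ord_max].
Definition half_space_boundary : set V := [set x | x 0 ord_max = 0].

Definition row_of_tuple (t : n.+1.-tuple (measurableTypeR R)) : V :=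
  \row_i tnth t i.

Definition half_space_integral (f : V -> R) : \bar R :=
  (\int[@lebesgue_tuple R n.+1]_(t in row_of_tuple @^-1` half_space)
     (f (row_of_tuple t))%:E)%E.

Definition half_space_integrable (f : V -> R) : Prop :=
  (@lebesgue_tuple R n.+1).-integrable (row_of_tuple @^-1` half_space)
    (fun t => (f (row_of_tuple t))%:E).

Definition basis_vector (k : 'I_n.+1) : V := delta_mx 0 k.

Definition component (v : V -> V) (j : 'I_n.+1) : V -> R := fun x => v x 0 j.

Definition partial (k : 'I_n.+1) (f : V -> R) : V -> R :=
  fun x => 'D_(basis_vector k) f x.

Definition divergence (v : V -> V) : V -> R :=
  fun x => \sum_i partial i (component v i) x.

Definition laplacian (f : V -> R) : V -> R :=
  fun x => \sum_k partial k (partial k f) x.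

Definition convection (v : V -> V) (j : 'I_n.+1) : V -> R :=
  fun x => \sum_i v x 0 i * partial i (component v j) x.

Definition grad_convection_dot_grad (v : V -> V) : V -> R :=
  fun x => \sum_j \sum_k
    partial k (convection v j) x * partial k (component v j) x.

(* The norm of the library on row vectors is the max norm. *)
Definition euclidean_norm (x : V) : R := Num.sqrt (\sum_i x 0 i ^+ 2).

Definition grad_norm (v : V -> V) : V -> R :=
  fun x => Num.sqrt (\sum_j \sum_k partial k (component v j) x ^+ 2).

Definition hessian_norm (v : V -> V) : V -> R :=
  fun x => Num.sqrt
    (\sum_i \sum_j \sum_k partial i (partial k (component v j)) x ^+ 2).

Definition tangential (x : V) : V :=
  \row_j (if j == ord_max then 0 else x 0 j).

Definition time_difference_quotient (f : R -> R) (t h : R) : R :=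
  h^-1 * (f (t + h) - f t).

(* Increments h that keep t + h in (0, T]: the derivative at t = T is the
   left derivative. *)
Definition time_increments (T t : R) : set_system R :=
  within [set h | 0 < t + h <= T] 0^'.

Definition time_derivative (T : R) (f : R -> R) (t : R) : R :=
  lim (time_difference_quotient f t h @[h --> time_increments T t]).

Definition has_continuous_extension (f : V -> R) : Prop :=
  exists g : V -> R, {within closed_half_space, continuous g} /\
    (forall x, half_space x -> g x = f x).

(* C^2 in the open half-space and C^1 up to the boundary. *)
Record C2_C1bar (v : V -> V) : Prop := {
  c1_continuous : {within closed_half_space, continuous v} ;
  c1_derivable : forall j k x, half_space x ->
    derivable (component v j) x (basis_vector k) ;
  c1_extension : forall j k,
    has_continuous_extension (partial k (component v j)) ;
  c2_derivable : forall i j k x, half_space x ->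
    derivable (partial k (component v j)) x (basis_vector i) ;
  c2_continuous : forall i j k x, half_space x ->
    {for x, continuous (partial i (partial k (component v j)))} }.

(* The normal derivative at a boundary point is the one-sided derivative along
   the inner normal; only values of v on the closed half-space are used. *)
Definition slip_boundary_condition (v : V -> V) : Prop :=
  forall x, half_space_boundary x ->
    v x 0 ord_max = 0 /\
    (forall j, j != ord_max ->
       h^-1 * (v (x + h *: basis_vector ord_max) 0 j - v x 0 j)
         @[h --> 0^'+] --> 0).

(* u is the velocity and p the pressure of a classical solution with
   viscosity mu and initial velocity u0 on the time interval (0, T]. *)
Record navier_stokes_solution (mu T : R) (u0 : V -> V)
    (u : R -> V -> V) (p : R -> V -> R) : Prop := {
  ns_velocity_space : forall t : R, 0 < t <= T -> C2_C1bar (u t) ;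
  ns_velocity_time : forall (t : R) x j, 0 < t <= T -> half_space x ->
    cvg (time_difference_quotient (fun s => u s x 0 j) t h
           @[h --> time_increments T t]) ;
  ns_pressure : forall (t : R) x j, 0 < t <= T -> half_space x ->
    derivable (p t) x (basis_vector j) ;
  ns_momentum : forall (t : R) x j, 0 < t <= T -> half_space x ->
    time_derivative T (fun s => u s x 0 j) t + convection (u t) j x
      - mu * laplacian (component (u t) j) x + partial j (p t) x = 0 ;
  ns_incompressible : forall (t : R) x, 0 < t <= T -> half_space x ->
    divergence (u t) x = 0 ;
  ns_initial : forall x, half_space x ->
    u 0 x = u0 x /\ u t x @[t --> 0^'+] --> u0 x }.

End half_space.

(* Main.v *)
Require Import Defs.
From mathcomp Require Import all_boot all_order all_algebra.
From mathcomp Require Import ring lra.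
From mathcomp Require Import all_classical all_reals all_analysis.
From mathcomp Require Import measurable_realfun.

(** Expanding the derivative of the convection term, the integrand is

      sum_(i,j,k) d_k u_i d_i u_j d_k u_j + 1/2 u . grad (|grad u|^2).

    The second sum is the divergence of u |grad u|^2 / 2, since div u = 0. Each
    product of the first sum contains a derivative of a tangential component
    of u: this is clear unless i = j = n, and then the factor d_n u_n equals
    minus the sum of the d_l u_l over l < n. Integrating that derivative by
    parts produces terms of the form u_l (d d u) (d u) with l < n, which are
    bounded by |ubar| |grad u| |grad^2 u|. In pointwise form, the integrand is
    div G - E, where G (flux_field) is cubic in u and grad u and every term of
    E (flux_field_error) has a tangential component of u as a factor; the
    identity is flux_divergence, which rests on div u = 0 and on the symmetry of
    second derivatives (partialC).

    It remains to see that the integral of div G vanishes. If the right-hand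
    side of the inequality is infinite there is nothing to prove; otherwise E
    is integrable, hence so is div G, while G is integrable because it is
    bounded by |u| |grad u|^2. The normal component of G tends to zero at the
    boundary: by the slip condition the boundary values of u_n, of d_k u_n with
    k < n and of d_n u_j with j < n are all zero
    (tangential_derivative_boundary, normal_derivative_boundary), and every
    term of G_n contains one of them.

    The divergence theorem (half_space_divergence) is proved with the cutoffs

      phi(x) = p(1 - |x|^2 / r^2) p(1 - p(2 - x_n / eps)),  p(s) = max(0, s)^2,

    which are C1, at most 1, and vanish for |x| >= r and for x_n <= eps. The
    field phi G is C1 with compact support in the open half-space, so each
    d_i (phi G_i) has integral zero by Fubini and the fundamental theorem of
    calculus (integral_partial_compact). The term grad phi . G is at most 4 / r
    times the sum of the |G_i|, plus 4 / eps |G_n| on a layer of height 2 eps.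
    Since |G_n| <= delta there if eps is small with respect to r and delta, the
    latter has an integral of at most 8 delta (2 r)^(n-1). Letting r tend to
    infinity, with delta and then eps chosen small for each r, gives the claim
    by dominated convergence. *)

Import Order.TTheory GRing.Theory Num.Theory.
Import numFieldNormedType.Exports.

Set Implicit Arguments.
Unset Strict Implicit.
Unset Printing Implicit Defensive.

Local Open Scope classical_set_scope.
Local Open Scope ring_scope.

(** * Measurability of continuous functions of a row vector *)

Section measurability.
Context {R : realType} {n : nat}.
Local Notation V := 'rV[R]_n.+1.
Local Notation T := (n.+1.-tuple (measurableTypeR R)).

Definition grid_point (m : nat) (x : V) : V :=
  \row_i ((Num.floor (m.+1%:R * x 0 i))%:~R / m.+1%:R).

Lemma grid_point_cvg (x : V) : grid_point m x @[m --> \oo] --> x.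
Proof.
apply/cvgrPdist_le => e e0; near=> m.
rewrite [leLHS]/Num.norm /= mx_normrE; apply: bigmax_le; first exact: ltW.
move=> [a i] _ /=; rewrite (ord1 a) !mxE.
have m0 : (0 : R) < m.+1%:R by [].
have /andP[fl fr] := floor_itv (m.+1%:R * x 0 i).
apply: (@le_trans _ _ m.+1%:R^-1); last first.
  by apply: ltW; near: m; exact: (near_infty_natSinv_lt (PosNum e0)).
move: (Num.floor _) fl fr => k fl fr.
rewrite (_ : x 0 i - k%:~R / m.+1%:R = (m.+1%:R * x 0 i - k%:~R) / m.+1%:R);
  last by field.
rewrite normrM (gtr0_norm (x := m.+1%:R^-1)) ?invr_gt0//.
rewrite -[leRHS]mul1r ler_wpM2r// ?invr_ge0 ?ltW// ger0_norm ?subr_ge0//.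
by rewrite ltrBlDl -(intrD1 k).
Unshelve. all: by end_near. Qed.

(** A function of the grid point takes countably many values, each on a
    measurable set: a countable union of the cells of the grid. *)
Lemma measurable_grid_point (m : nat) (f : V -> R) :
  measurable_fun [set: T] (fun t => f (grid_point m (row_of_tuple t))).
Proof.
move=> _ B mB; rewrite setTI.
pose g (z : 'rV[int]_n.+1) : V := \row_i ((z 0 i)%:~R / m.+1%:R).
pose cell (z : 'rV[int]_n.+1) : set T :=
  \bigcap_(i in [set: 'I_n.+1])
    (fun t : T => tnth t i) @^-1`
    [set y : R | (z 0 i)%:~R <= m.+1%:R * y < (z 0 i + 1)%:~R].
have -> : (fun t : T => f (grid_point m (row_of_tuple t))) @^-1` B =
    \bigcup_z (if f (g z) \in B then cell z else set0).
  apply/seteqP; split=> t /=.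
    move=> ft; exists (\row_i Num.floor (m.+1%:R * tnth t i)) => //.
    rewrite (_ : g _ = grid_point m (row_of_tuple t)); last first.
      by apply/rowP => i; rewrite !mxE.
    by rewrite mem_set// => i _ /=; rewrite mxE floor_itv.
  move=> [z _]; case: ifPn => // /[!inE] + tz.
  rewrite (_ : g _ = grid_point m (row_of_tuple t))//.
  apply/rowP => i; rewrite !mxE; congr (_%:~R / _).
  by apply/esym/floor_def/(tz i).
apply: countable_bigcupT_measurable => [|z]; first exact: countableP.
case: ifPn => // _.
apply: fin_bigcap_measurable => // i _.
rewrite -[X in measurable X]setTI; apply: measurable_tnth => //.
rewrite (_ : [set _ | _] = (fun y : R => m.+1%:R * y) @^-1`
   `[(z 0 i)%:~R, (z 0 i + 1)%:~R[); last first.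
  by apply/seteqP; split => y /=; rewrite in_itv.
rewrite -[X in measurable X]setTI.
by apply: measurable_funM => //; exact: measurable_itv.
Qed.

(** Tuples carry the product sigma-algebra and not a Borel one, so continuity
    does not give measurability directly: [f] is the pointwise limit of its
    values at the grid points, which lie near every point of [D] but possibly
    outside [D]. This is why continuity is asked in full neighbourhoods. *)
Lemma measurable_continuous_on (D : set V) (f : V -> R) :
  measurable ((@row_of_tuple R n) @^-1` D) ->
  (forall x, D x -> {for x, continuous f}) ->
  measurable_fun (row_of_tuple @^-1` D) (f \o (@row_of_tuple R n)).
Proof.
move=> mD cf.
apply: (@measurable_fun_cvg _ _ _ _ (fun m t => f (grid_point m (row_of_tuple t)))).
  by move=> m; apply: measurable_funTS; exact: measurable_grid_point.
move=> t Dt /=.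
by apply: continuous_cvg; [exact: cf|exact: grid_point_cvg].
Qed.

End measurability.

(** * Fubini slices and boxes for Lebesgue measure on tuples *)

Section slices.
Context {R : realType}.
Local Notation T := (measurableTypeR R).

Definition tuple_update n (t : n.-tuple T) (i : 'I_n) (s : R) : n.-tuple T :=
  [tuple (if k == i then s else tnth t k) | k < n].

Lemma tuple_update_cons0 n (t : n.-tuple T) (x s : R) :
  tuple_update (tuple_cons (x, t)) ord0 s = tuple_cons (s, t).
Proof.
apply: eq_from_tnth => k; rewrite tnth_mktuple.
have [->|] := eqVneq k ord0; first by rewrite tnth0.
by case: (unliftP ord0 k) => [j ->|->]; rewrite ?eqxx// !tnthS.
Qed.

Lemma tuple_update_cons_lift n (t : n.-tuple T) (i : 'I_n) (x s : R) :
  tuple_update (tuple_cons (x, t)) (lift ord0 i) s =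
  tuple_cons (x, tuple_update t i s).
Proof.
apply: eq_from_tnth => k; rewrite tnth_mktuple.
case: (unliftP ord0 k) => [j ->|->]; last by rewrite !tnth0.
by rewrite !tnthS tnth_mktuple (inj_eq lift_inj).
Qed.

Section cons.
Variables (n : nat) (h : n.+1.-tuple T -> \bar R).
Hypothesis hi : (lebesgue_tuple n.+1).-integrable [set: n.+1.-tuple T] h.

Lemma integrable_tuple_cons :
  ((@lebesgue_measure R) \x lebesgue_tuple n)%E.-integrable
    [set: T * n.-tuple T] (h \o @tuple_cons R n).
Proof.
have /integrableP[mh hoo] := hi.
apply/integrableP; split.
  by apply: measurableT_comp mh _; exact: measurable_tuple_cons.
move: hoo; rewrite /= /lebesgue_cons.
rewrite (@ge0_integral_pushforward _ _ _ _ _ _ (@measurable_tuple_cons R n))//.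
exact: measurableT_comp.
Qed.

Lemma integral_tuple_cons :
  (\int[lebesgue_tuple n.+1]_t h t =
   \int[(@lebesgue_measure R) \x lebesgue_tuple n]_p h (tuple_cons p))%E.
Proof.
have mh := measurable_int _ hi.
rewrite /= /lebesgue_cons.
rewrite (@integral_pushforward _ _ _ _ _ _ (@measurable_tuple_cons R n))//.
exact: integrable_tuple_cons.
Qed.
End cons.

(** Peeling off the coordinates one at a time, Fubini's theorem lets any
    coordinate be integrated first. The inner integrals need to vanish for
    almost every choice of the other coordinates only, because the slices of
    an integrable function are integrable almost everywhere. *)
Lemma integral_slices_eq0 n (i : 'I_n) (h : n.-tuple T -> \bar R) :
  (lebesgue_tuple n).-integrable [set: n.-tuple T] h ->
  (forall t, \int[@lebesgue_measure R]_s h (tuple_update t i s) = 0)%E ->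
  (\int[lebesgue_tuple n]_t h t = 0)%E.
Proof.
elim: n i h => [[]//|n IH] i h hi hs.
have ci := integrable_tuple_cons hi.
rewrite integral_tuple_cons//.
case: (unliftP ord0 i) => [j ij|i0].
  rewrite -(integral12_prod_meas1 ci).
  rewrite (ae_eq_integral (cst 0%E))//; first exact: integral0.
    exact: (measurable_fubini_F ci).
  have := ae_integrable1 ci; apply: filterS => x xi _.
  apply: (IH j) => // t.
  rewrite -[RHS](hs (tuple_cons (x, t))); apply: eq_integral => s _ /=.
  by rewrite ij tuple_update_cons_lift.
rewrite -(integral21_prod_meas1 ci).
rewrite (_ : fubini_G _ _ = cst 0%E); first exact: integral0.
apply/funext => t; rewrite -[RHS](hs (tuple_cons (0, t))) /fubini_G.
by apply: eq_integral => s _ /=; rewrite i0 tuple_update_cons0.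
Qed.

Definition tuple_box n (a b : 'I_n -> R) : set (n.-tuple T) :=
  [set t | forall i, a i <= tnth t i <= b i].

Lemma measurable_tuple_box n (a b : 'I_n -> R) : measurable (tuple_box a b).
Proof.
rewrite (_ : tuple_box a b = \bigcap_(i in [set: 'I_n])
    (fun t : n.-tuple T => tnth t i) @^-1` `[a i, b i]); last first.
  apply/seteqP; split => t /=.
    by move=> tab i _; rewrite /= in_itv/=.
  by move=> tab i; have := tab i I; rewrite /= in_itv/=.
apply: fin_bigcap_measurable => // i _.
by rewrite -[X in measurable X]setTI; apply: measurable_tnth.
Qed.

Lemma lebesgue_tuple_box n (a b : 'I_n -> R) : (forall i, a i <= b i) ->
  lebesgue_tuple n (tuple_box a b) = (\prod_i (b i - a i))%:E.
Proof.
elim: n a b => [|n IH] a b ab.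
  rewrite big_ord0 /= /dirac indicE mem_set//; by case.
rewrite /= /lebesgue_cons /pushforward.
rewrite (_ : _ @^-1` _ = `[a ord0, b ord0] `*`
   tuple_box (fun i => a (lift ord0 i)) (fun i => b (lift ord0 i))).
  rewrite product_measure1E//; last exact: measurable_tuple_box.
  rewrite IH// big_ord_recl EFinM; congr (_ * _)%E.
  apply: (etrans (lebesgue_measure_itv _)); rewrite /= lte_fin.
  by case: ltgtP (ab ord0) => // ->; rewrite subrr.
apply/seteqP; split => -[x t] /= xt.
  split=> [|i]; first by have := xt ord0; rewrite tnth0 in_itv.
  by have := xt (lift ord0 i); rewrite tnthS.
case: xt => xab tab i.
by case: (unliftP ord0 i) => [j ->|->]; rewrite ?tnth0 ?tnthS.
Qed.

End slices.

(** * Integrals of derivatives of compactly supported functions *)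

Section lines.
Context {R : realType}.

(** A directional derivative is the derivative of the restriction to a line;
    this reduces all calculus in several variables below to one variable. *)
Lemma is_derive_line (W : normedModType R) (f : W -> R) (x v : W) (s : R) :
  derivable f (x + s *: v) v ->
  is_derive s 1 (fun s => f (x + s *: v)) ('D_v f (x + s *: v)).
Proof.
pose g s := f (x + s *: v).
have E : (fun h : R => h^-1 *: ((g \o shift s) (h *: 1) - g s)) =
    (fun h => h^-1 *: ((f \o shift (x + s *: v)) (h *: v) - f (x + s *: v))).
  apply/funext => h; rewrite /g /= [h *: 1]mulr1 scalerDl.
  by rewrite addrCA.
by move=> df; split; rewrite /derivable /derive E.
Qed.

Lemma continuous_line (W : normedModType R) (x v : W) :
  continuous (fun s : R => x + s *: v).
Proof.
by move=> s; apply: cvgD; [exact: cvg_cst|apply: cvgZr_tmp; exact: cvg_id].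
Qed.

End lines.

Section compact_support.
Context {R : realType} {n : nat}.
Local Notation V := 'rV[R]_n.+1.
Local Notation T := (n.+1.-tuple (measurableTypeR R)).

Lemma row_of_tuple_update (t : T) i s :
  row_of_tuple (tuple_update t i s) =
  row_of_tuple (tuple_update t i 0) + s *: basis_vector i :> V.
Proof.
apply/rowP => k; rewrite /basis_vector !mxE !tnth_mktuple eqxx/=.
by case: (eqVneq k i) => _; rewrite ?mulr1 ?add0r// mulr0 addr0.
Qed.

Lemma component_continuous (i : 'I_n.+1) : continuous (fun x : V => x 0 i).
Proof. exact: coord_continuous. Qed.

Lemma compact_cube (r : R) : compact [set x : V | forall k, -r <= x 0 k <= r].
Proof.
rewrite (_ : [set _ | _] = [set x : V | forall k, `[-r, r]%classic (x ord0 k)]).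
  by apply: (@rV_compact _ _ (fun=> `[-r, r]%classic)) => _; exact: segment_compact.
by apply/seteqP; split => x /= xr k; have := xr k; rewrite in_itv.
Qed.

Variables (f : V -> R) (i : 'I_n.+1) (r : R).
Hypothesis r0 : 0 < r.
Hypothesis df : forall x : V, derivable f x (basis_vector i).
Hypothesis cf : continuous (partial i f).
Hypothesis f0 : forall (x : V) k, r < `|x 0 k| -> f x = 0.

Let pf0 (x : V) k : r < `|x 0 k| -> partial i f x = 0.
Proof.
move=> rx; rewrite /partial -[RHS](derive_cst 0 x (basis_vector i)).
apply: near_eq_derive; near=> y.
apply: (f0 (k := k)); near: y.
by apply: (cvgr_norm_gt (x 0 k)) => //; exact: component_continuous.
Unshelve. all: by end_near. Qed.

Lemma integrable_partial_compact :
  (lebesgue_tuple n.+1).-integrable [set: T]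
    (fun t => (partial i f (row_of_tuple t))%:E).
Proof.
pose B : set T := tuple_box (fun=> -r) (fun=> r).
have mB : measurable B by exact: measurable_tuple_box.
have mpf : measurable_fun [set: T] (partial i f \o @row_of_tuple R n).
  have := @measurable_continuous_on R n [set: V] (partial i f).
  by rewrite preimage_setT; apply=> // x _; exact: cf.
rewrite (_ : (fun t => _) = ((fun t => (partial i f (row_of_tuple t))%:E) \_ B)).
  apply/(integrable_mkcond _ mB).
  apply: (@measurable_bounded_integrable _ T R _ (partial i f \o @row_of_tuple R n)) => //.
  - suff : (lebesgue_tuple n.+1 B < +oo)%E by [].
    by rewrite lebesgue_tuple_box ?ltry// => _ /=; by rewrite (le_trans _ (ltW r0))// oppr_le0 ltW.
  - exact: measurable_funTS.
  - have := compact_bounded (continuous_compact (continuous_subspaceT cf)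
      (@compact_cube r)).
    move=> [M [Mreal MH]]; exists M; split => // N /MH {}MH t Bt /=.
    apply: MH; exists (row_of_tuple t) => // k.
    by rewrite mxE; exact: Bt.
apply/funext => t; rewrite patchE; case: ifPn => // /negP tB.
have [k tk] : exists k, r < `|tnth t k|.
  apply: contra_notP tB => /forallNP tB; rewrite inE => k.
  by rewrite -ler_norml; have /negP := tB k; rewrite -leNgt.
by rewrite (pf0 (k := k)) ?mxE.
Qed.

(** On each line in direction [i] the integral of the derivative is the
    difference of two values of [f] outside its support. *)
Lemma integral_partial_compact :
  (\int[lebesgue_tuple n.+1]_t (partial i f (row_of_tuple t))%:E = 0)%E.
Proof.
apply: (integral_slices_eq0 (i := i)); first exact: integrable_partial_compact.
move=> t.
pose x : V := row_of_tuple (tuple_update t i 0).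
pose g s := f (x + s *: basis_vector i).
pose dg s := partial i f (x + s *: basis_vector i).
have gE (s : R) : is_derive s 1 g (dg s) by exact: is_derive_line.
have cg : continuous g.
  by move=> s; apply: differentiable_continuous; apply/derivable1_diffP.
have cdg : continuous dg.
  move=> s; apply: continuous_comp; [exact: continuous_line|exact: cf].
have xs (s : R) : (x + s *: basis_vector i) 0 i = s.
  by rewrite -row_of_tuple_update mxE tnth_mktuple eqxx.
(* The margin 1 puts both endpoints outside the support of [f]. *)
transitivity (\int[@lebesgue_measure R]_(s in `[(- (r + 1))%R, (r + 1)%R]) (dg s)%:E)%E.
  rewrite [RHS]integral_mkcond; apply: eq_integral => s _.
  rewrite row_of_tuple_update patchE -/x -/(dg s); case: ifPn => // /negP sr.
  rewrite /dg (pf0 (k := i))// xs ltNge; apply: contra_notN sr.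
  by rewrite inE/= in_itv/= -ler_norml => sr; rewrite (le_trans sr)// lerDl.
rewrite (@continuous_FTC2 _ dg g)//.
- have nr : r < `|r + 1| by rewrite gtr0_norm ?addr_gt0// ltrDl.
  by rewrite /g (f0 (k := i)) ?xs// (f0 (k := i)) ?xs ?normrN// sube0.
- by rewrite (@lt_trans _ _ 0)// ?oppr_lt0 addr_gt0.
- exact: continuous_subspaceT.
- split => [s _| |].
  + exact: ex_derive.
  + apply: cvg_at_right_filter; exact: cg.
  + apply: cvg_at_left_filter; exact: cg.
- by move=> s _; rewrite derive1E; apply: derive_val.
Qed.

End compact_support.

(** * A squared positive part as a C1 profile *)

Section chain.
Context {R : realType}.

(** Reduced to the chain rule in one variable on the line through [x] in
    direction [v]. *)
Lemma is_derive_chain (W : normedModType R) (f : W -> R) (p : R -> R)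
    (x v : W) (df dp : R) :
  is_derive x v f df -> is_derive (f x) 1 p dp ->
  is_derive x v (p \o f) (dp * df).
Proof.
move=> [fx <-] pf.
have fx0 : derivable f (x + 0 *: v) v by rewrite scale0r addr0.
have := is_derive_line fx0; rewrite scale0r addr0 => gd.
pose g s := f (x + s *: v).
have pg : is_derive (g 0) 1 p dp by rewrite /g scale0r addr0.
have := @is_derive1_comp _ p g 0 _ _ pg gd.
have E : (fun h : R => h^-1 *: (((p \o g) \o shift 0) (h *: 1) - (p \o g) 0)) =
    (fun h => h^-1 *: (((p \o f) \o shift x) (h *: v) - (p \o f) x)).
  apply/funext => h; rewrite /g /= [h *: 1]mulr1 addr0 scale0r addr0.
  by rewrite (addrC x).
by move=> [d1 d2]; split; move: d1 d2; rewrite /derivable /derive E.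
Qed.

End chain.

Section positive_part_square.
Context {R : realType}.
Implicit Types s : R.

Definition pos_part s : R := Num.max 0 s.

(** The simplest C1 function that vanishes on a half-line: all cutoffs are
    built from it. *)
Definition pos_sqr s : R := pos_part s ^+ 2.

Lemma pos_part_ge0 s : 0 <= pos_part s.
Proof. by rewrite le_max lexx. Qed.

Lemma pos_part_id s : 0 <= s -> pos_part s = s.
Proof. by move=> s0; exact/max_idPr. Qed.

Lemma pos_part_eq0 s : s <= 0 -> pos_part s = 0.
Proof. by move=> s0; exact/max_idPl. Qed.

Lemma pos_part_le s a : 0 <= a -> s <= a -> pos_part s <= a.
Proof. by rewrite ge_max => -> ->. Qed.

Lemma pos_part_continuous : continuous pos_part.
Proof.
move=> s; apply: (@continuous_max R _ (cst 0) id); first exact: cst_continuous.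
exact: cvg_id.
Qed.

Lemma pos_sqr_continuous : continuous pos_sqr.
Proof.
by move=> s; apply: cvgM; exact: pos_part_continuous.
Qed.

Lemma pos_sqr_ge0 s : 0 <= pos_sqr s.
Proof. exact: sqr_ge0. Qed.

Lemma pos_sqr_le1 s : s <= 1 -> pos_sqr s <= 1.
Proof. by move=> s1; rewrite expr_le1// ?pos_part_ge0// pos_part_le. Qed.

(** A second-order bound, uniform in the sign of [s] and of [s + h], gives the
    derivative at the corner point 0 together with the others. *)
Lemma pos_sqr_taylor s h :
  `|pos_sqr (s + h) - pos_sqr s - 2 * pos_part s * h| <= h ^+ 2.
Proof.
rewrite ler_norml /pos_sqr.
have [s0|s0] := leP 0 s; have [h0|h0] := leP 0 (s + h).
- rewrite !pos_part_id//; nra.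
- rewrite (pos_part_id s0) (pos_part_eq0 (ltW h0)); nra.
- rewrite (pos_part_id h0) (pos_part_eq0 (ltW s0)); nra.
- rewrite (pos_part_eq0 (ltW h0)) (pos_part_eq0 (ltW s0)); nra.
Qed.

Lemma is_derive_pos_sqr s : is_derive s 1 pos_sqr (2 * pos_part s).
Proof.
have H : h^-1 *: ((pos_sqr \o shift s) (h *: 1) - pos_sqr s) @[h --> 0^'] -->
    2 * pos_part s.
  apply/cvgrPdist_le => e e0; near=> h.
  have hn0 : h != 0 by near: h; exact: nbhs_dnbhs_neq.
  have -> : 2 * pos_part s - h^-1 *: ((pos_sqr \o shift s) (h *: 1) - pos_sqr s) =
      - (h^-1 * (pos_sqr (s + h) - pos_sqr s - 2 * pos_part s * h)).
    have scE (a b : R) : a *: b = a * b by [].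
    by rewrite /= !scE mulr1 (addrC h); field.
  rewrite normrN normrM normfV ler_pdivrMl ?normr_gt0//.
  apply: (le_trans (pos_sqr_taylor _ _)).
  rewrite -real_normK ?num_real// expr2 ler_wpM2l//.
  near: h; apply: nbhs_dnbhs.
  exact: (@nbhs0_le _ R _ e0).
split; first by apply/cvg_ex; eexists; exact: H.
by apply: cvg_lim => //; exact: H.
Unshelve. all: by end_near. Qed.

End positive_part_square.

(** * Cutoff functions of the half-space *)

Section pointwise_continuity.
Context {R : realType} {n : nat}.
Local Notation X := 'rV[R]_n.+1.
Implicit Types (f g : X -> R) (x : X).

(** These rules are stated at a point and for explicit abstractions on row
    vectors, the form in which the functions below are built. *)
Lemma continuous_at_cst (a : R) x : {for x, continuous (fun=> a : R)}.
Proof. exact: cst_continuous. Qed.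

Lemma continuous_atD f g x : {for x, continuous f} -> {for x, continuous g} ->
  {for x, continuous (fun y => f y + g y : R)}.
Proof. exact: continuousD. Qed.

Lemma continuous_atN f x : {for x, continuous f} -> {for x, continuous (fun y => - f y : R)}.
Proof. exact: continuousN. Qed.

Lemma continuous_atM f g x : {for x, continuous f} -> {for x, continuous g} ->
  {for x, continuous (fun y => f y * g y : R)}.
Proof. exact: continuousM. Qed.

Lemma continuous_at_sum (I : Type) (r : seq I) (P : pred I) (f : I -> X -> R) x :
  (forall i, P i -> {for x, continuous (f i)}) ->
  {for x, continuous (fun y => \sum_(i <- r | P i) f i y : R)}.
Proof.
move=> cf; apply: (@cvg_big _ _ _ _ _ _ _ (nbhs x)) => //; exact: add_continuous.
Qed.

Lemma continuous_at_comp (p : R -> R) f x : continuous p -> {for x, continuous f} ->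
  {for x, continuous (fun y => p (f y))}.
Proof. by move=> cp cf; exact: (@continuous_comp _ _ _ f p x cf (cp (f x))). Qed.

End pointwise_continuity.

Section cutoff.
Context {R : realType} {n : nat}.
Local Notation V := 'rV[R]_n.+1.
Implicit Types (x : V) (r eps s : R) (k : 'I_n.+1).

Lemma is_derive_component (v : V) x k :
  is_derive x v (fun y : V => y 0 k) (v 0 k).
Proof.
have H : h^-1 *: (((fun y : V => y 0 k) \o shift x) (h *: v) - x 0 k)
    @[h --> (0 : R)^'] --> v 0 k.
  apply: cvg_near_cst; near=> h.
  have h0 : h != 0 by near: h; exact: nbhs_dnbhs_neq.
  rewrite /= !mxE addrK.
  by rewrite scalerA mulVf// scale1r.
split; first by apply/cvg_ex; eexists; exact: H.
by apply: cvg_lim => //; exact: H.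
Unshelve. all: by end_near. Qed.

Definition sqr_norm x : R := \sum_i x 0 i ^+ 2.

Definition radial_cutoff r x : R := pos_sqr (1 - sqr_norm x / r ^+ 2).

(** Increases from 0 for [s <= eps] to 1 for [s >= 2 * eps]. *)
Definition layer_cutoff eps s : R := pos_sqr (1 - pos_sqr (2 - s / eps)).

Definition layer_cutoff_derivative eps s : R :=
  4 / eps * pos_part (1 - pos_sqr (2 - s / eps)) * pos_part (2 - s / eps).

Definition cutoff r eps x : R :=
  radial_cutoff r x * layer_cutoff eps (x 0 ord_max).

Definition radial_cutoff_partial r k x : R :=
  2 * pos_part (1 - sqr_norm x / r ^+ 2) * (- (2 * x 0 k / r ^+ 2)).

Definition cutoff_partial r eps k x : R :=
  radial_cutoff_partial r k x * layer_cutoff eps (x 0 ord_max) +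
  radial_cutoff r x *
    (if k == ord_max then layer_cutoff_derivative eps (x 0 ord_max) else 0).

Lemma sqr_norm_continuous : continuous sqr_norm.
Proof.
by move=> x; apply: continuous_at_sum => i _; apply: continuous_atM; exact: component_continuous.
Qed.

Lemma component_le_sqr_norm x k : x 0 k ^+ 2 <= sqr_norm x.
Proof.
rewrite /sqr_norm (bigD1 k)//= lerDl sumr_ge0// => i _; exact: sqr_ge0.
Qed.

Lemma is_derive_sqr_norm x k :
  is_derive x (basis_vector k) sqr_norm (2 * x 0 k).
Proof.
have H i : is_derive x (basis_vector k) (fun y : V => y 0 i ^+ 2)
    (2 * x 0 i * (i == k)%:R).
  have xi := is_derive_component (basis_vector k) x i.
  apply: is_derive_eq; rewrite /basis_vector mxE eqxx /=.
  by rewrite -scalerDl -mulr2n mulr_natl.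
rewrite (_ : sqr_norm = \sum_i (fun y : V => y 0 i ^+ 2)); last first.
  by apply/funext => y; rewrite fct_sumE.
apply: is_derive_eq; rewrite (bigD1 k)//= eqxx mulr1 big1 ?addr0// => i ik.
by rewrite (negbTE ik) mulr0.
Qed.

Lemma is_derive_cutoff r eps k x : r != 0 -> eps != 0 ->
  is_derive x (basis_vector k) (cutoff r eps) (cutoff_partial r eps k x).
Proof.
move=> r0 e0.
have scE (a b : R) : a *: b = a * b by [].
have d1 : is_derive x (basis_vector k)
    (fun y => 1 - sqr_norm y / r ^+ 2) (- (2 * x 0 k / r ^+ 2)).
  have ds := is_derive_sqr_norm x k.
  rewrite (_ : (fun y => _) = cst 1 - (r ^+ 2)^-1 *: sqr_norm); last first.
    by apply/funext => y /=; rewrite mulrC.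
  by apply: is_derive_eq; rewrite sub0r scE mulrC.
have d2 := is_derive_chain d1 (is_derive_pos_sqr _).
have d3 : is_derive x (basis_vector k)
    (fun y => 2 - y 0 ord_max / eps) (- ((k == ord_max)%:R / eps)).
  have dc := is_derive_component (basis_vector k) x ord_max.
  rewrite (_ : (fun y => _) =
    cst 2 - eps^-1 *: (fun y : V => y 0 ord_max)); last first.
    by apply/funext => y /=; rewrite mulrC.
  apply: is_derive_eq; rewrite sub0r scE mulrC /basis_vector mxE eqxx/=.
  by rewrite (eq_sym k).
have d4 := is_derive_chain d3 (is_derive_pos_sqr _).
have d5 : is_derive x (basis_vector k)
    (fun y => 1 - pos_sqr (2 - y 0 ord_max / eps))
    (- (2 * pos_part (2 - x 0 ord_max / eps) * - ((k == ord_max)%:R / eps))).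
  rewrite (_ : (fun y => _) = cst 1 -
    (pos_sqr \o (fun y : V => 2 - y 0 ord_max / eps)))//.
  by apply: is_derive_eq; rewrite sub0r.
have d6 := is_derive_chain d5 (is_derive_pos_sqr _).
rewrite (_ : cutoff r eps =
  (pos_sqr \o (fun y => 1 - sqr_norm y / r ^+ 2)) *
  (pos_sqr \o (fun y => 1 - pos_sqr (2 - y 0 ord_max / eps))))//.
apply: is_derive_eq.
rewrite /cutoff_partial /radial_cutoff_partial /radial_cutoff /layer_cutoff /=.
rewrite /layer_cutoff_derivative.
rewrite !scE.
by case: ifPn => _ /=; field; rewrite ?r0 ?e0.
Qed.

Lemma layer_cutoff_ge0 eps s : 0 <= layer_cutoff eps s.
Proof. exact: pos_sqr_ge0. Qed.

Lemma layer_cutoff_le1 eps s : layer_cutoff eps s <= 1.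
Proof. by rewrite pos_sqr_le1// lerBlDr lerDl pos_sqr_ge0. Qed.

Lemma radial_cutoff_ge0 r x : 0 <= radial_cutoff r x.
Proof. exact: pos_sqr_ge0. Qed.

Lemma sqr_norm_ge0 x : 0 <= sqr_norm x.
Proof. by apply: sumr_ge0 => i _; exact: sqr_ge0. Qed.

Lemma radial_cutoff_le1 r x : radial_cutoff r x <= 1.
Proof.
by rewrite pos_sqr_le1// lerBlDr lerDl divr_ge0 ?sqr_ge0 ?sqr_norm_ge0.
Qed.

Lemma inner_layer_eq0 eps s : 0 < eps -> s <= eps ->
  pos_part (1 - pos_sqr (2 - s / eps)) = 0.
Proof.
move=> e0 se; apply: pos_part_eq0; rewrite subr_le0.
have s1 : s / eps <= 1 by rewrite ler_pdivrMr ?mul1r.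
rewrite /pos_sqr pos_part_id; last lra.
rewrite -[leLHS](expr1n _ 2) lerXn2r ?nnegrE//; lra.
Qed.

Lemma layer_cutoff_near eps s : 0 < eps -> s <= eps -> layer_cutoff eps s = 0.
Proof. by move=> e0 se; rewrite /layer_cutoff /pos_sqr inner_layer_eq0// expr0n. Qed.

Lemma layer_cutoff_derivative_near eps s : 0 < eps -> s <= eps ->
  layer_cutoff_derivative eps s = 0.
Proof.
by move=> e0 se; rewrite /layer_cutoff_derivative inner_layer_eq0// mulr0 mul0r.
Qed.

Lemma outer_layer_eq0 eps s : 0 < eps -> 2 * eps <= s -> pos_part (2 - s / eps) = 0.
Proof.
by move=> e0 se; apply: pos_part_eq0; rewrite subr_le0 ler_pdivlMr.
Qed.

Lemma layer_cutoff_far eps s : 0 < eps -> 2 * eps <= s -> layer_cutoff eps s = 1.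
Proof.
move=> e0 se; rewrite /layer_cutoff /pos_sqr outer_layer_eq0// expr0n/= subr0.
by rewrite pos_part_id// expr1n.
Qed.

Lemma layer_cutoff_derivative_far eps s : 0 < eps -> 2 * eps <= s ->
  layer_cutoff_derivative eps s = 0.
Proof. by move=> e0 se; rewrite /layer_cutoff_derivative outer_layer_eq0// mulr0. Qed.

Lemma layer_cutoff_derivative_ge0 eps s : 0 < eps ->
  0 <= layer_cutoff_derivative eps s.
Proof.
by move=> e0; rewrite /layer_cutoff_derivative !mulr_ge0 ?pos_part_ge0 ?invr_ge0 ?ltW.
Qed.

(** For [s <= eps] the derivative is zero, and beyond [eps] the two positive
    parts are at most 1. *)
Lemma layer_cutoff_derivative_le eps s : 0 < eps ->
  layer_cutoff_derivative eps s <= 4 / eps.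
Proof.
move=> e0; have [se|se] := leP s eps.
  by rewrite layer_cutoff_derivative_near// divr_ge0// ltW.
rewrite /layer_cutoff_derivative -mulrA ler_piMr //; first by rewrite divr_ge0 ?ltW.
apply: mulr_ile1; rewrite ?pos_part_ge0 ?pos_part_le//.
  by rewrite lerBlDr lerDl pos_sqr_ge0.
have s1 : 1 < s / eps by rewrite ltr_pdivlMr ?mul1r.
lra.
Qed.

Lemma radial_cutoff_out r k x : 0 < r -> r < `|x 0 k| ->
  pos_part (1 - sqr_norm x / r ^+ 2) = 0.
Proof.
move=> r0 rx; apply: pos_part_eq0; rewrite subr_le0 ler_pdivlMr ?exprn_gt0//.
rewrite mul1r (le_trans _ (component_le_sqr_norm x k))//.
by rewrite -(real_normK (num_real (x 0 k))) lerXn2r ?nnegrE ?normr_ge0 ?ltW.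
Qed.

Lemma cutoff_out r eps k x : 0 < r -> r < `|x 0 k| -> cutoff r eps x = 0.
Proof.
move=> r0 rx; rewrite /cutoff /radial_cutoff /pos_sqr (radial_cutoff_out r0 rx).
by rewrite expr0n mul0r.
Qed.

(** The factor [x 0 k / r ^+ 2] of the derivative is at most [1 / r] on the
    support of the cutoff. *)
Lemma radial_cutoff_partial_le r k x : 0 < r ->
  `|radial_cutoff_partial r k x| <= 4 / r.
Proof.
move=> r0; have [xr|xr] := leP `|x 0 k| r; last first.
  rewrite /radial_cutoff_partial (radial_cutoff_out r0 xr) mulr0 mul0r normr0.
  by rewrite divr_ge0 ?ltW.
rewrite /radial_cutoff_partial !normrM normrN !normrM normfV.
rewrite (ger0_norm (pos_part_ge0 _)) (ger0_norm (ler0n _ 2)).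
rewrite (ger0_norm (sqr_ge0 r)).
have p1 : pos_part (1 - sqr_norm x / r ^+ 2) <= 1.
  by rewrite pos_part_le// lerBlDr lerDl divr_ge0 ?sqr_ge0 ?sqr_norm_ge0.
have p0 := pos_part_ge0 (1 - sqr_norm x / r ^+ 2).
rewrite (_ : 4 / r = (2 * 1) * (2 * r / r ^+ 2)); last first.
  by field; rewrite gt_eqF.
apply: ler_pM; rewrite ?mulr_ge0 ?invr_ge0 ?sqr_ge0//.
  by rewrite ler_wpM2l.
by rewrite ler_wpM2r ?invr_ge0 ?sqr_ge0// ler_wpM2l.
Qed.

Lemma radial_argument_continuous r :
  continuous (fun x => 1 - sqr_norm x / r ^+ 2 : R).
Proof.
move=> x; apply: continuous_atD; first exact: continuous_at_cst.
by apply: continuous_atN; apply: continuous_atM; [exact: sqr_norm_continuous|exact: continuous_at_cst].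
Qed.

Lemma layer_argument_continuous eps :
  continuous (fun x => 2 - x 0 ord_max / eps : R).
Proof.
move=> x; apply: continuous_atD; first exact: continuous_at_cst.
by apply: continuous_atN; apply: continuous_atM; [exact: component_continuous|exact: continuous_at_cst].
Qed.

Lemma inner_layer_continuous eps :
  continuous (fun x => 1 - pos_sqr (2 - x 0 ord_max / eps) : R).
Proof.
move=> x; apply: continuous_atD; first exact: continuous_at_cst.
apply: continuous_atN; apply: (@continuous_at_comp _ _ pos_sqr); first exact: pos_sqr_continuous.
exact: layer_argument_continuous.
Qed.

Lemma radial_cutoff_continuous r : continuous (radial_cutoff r).
Proof.
move=> x; apply: (@continuous_at_comp _ _ pos_sqr); first exact: pos_sqr_continuous.
exact: radial_argument_continuous.
Qed.

Lemma layer_cutoff_continuous eps :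
  continuous (fun x => layer_cutoff eps (x 0 ord_max)).
Proof.
move=> x; apply: (@continuous_at_comp _ _ pos_sqr); first exact: pos_sqr_continuous.
exact: inner_layer_continuous.
Qed.

Lemma cutoff_continuous r eps : continuous (cutoff r eps).
Proof.
move=> x; apply: continuous_atM; first exact: radial_cutoff_continuous.
exact: layer_cutoff_continuous.
Qed.

Lemma cutoff_partial_continuous r eps k : continuous (cutoff_partial r eps k).
Proof.
have cp := @pos_part_continuous R.
move=> x; apply: continuous_atD; apply: continuous_atM.
- apply: continuous_atM.
    apply: continuous_atM; first exact: continuous_at_cst.
    by apply: (@continuous_at_comp _ _ (@pos_part R)) => //; exact: radial_argument_continuous.
  apply: continuous_atN; apply: continuous_atM; last exact: continuous_at_cst.
  by apply: continuous_atM; [exact: continuous_at_cst|exact: component_continuous].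
- exact: layer_cutoff_continuous.
- exact: radial_cutoff_continuous.
- case: (k == ord_max); last exact: continuous_at_cst.
  apply: continuous_atM; last by apply: (@continuous_at_comp _ _ (@pos_part R)) => //; exact: layer_argument_continuous.
  apply: continuous_atM; first exact: continuous_at_cst.
  by apply: (@continuous_at_comp _ _ (@pos_part R)) => //; exact: inner_layer_continuous.
Qed.

End cutoff.

(** * Integration over the half-space *)

Section half_space_integral_theory.
Context {R : realType} {n : nat}.
Local Notation V := 'rV[R]_n.+1.
Local Notation T := (n.+1.-tuple (measurableTypeR R)).
Local Notation mu := (@lebesgue_tuple R n.+1).
Local Notation D := ((@row_of_tuple R n) @^-1` half_space).
Implicit Types (f g : V -> R) (x : V).

Lemma measurable_half_space : measurable D.
Proof.
rewrite (_ : D = (fun t : T => tnth t ord_max) @^-1` `]0, +oo[).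
  by rewrite -[X in measurable X]setTI; apply: measurable_tnth.
by apply/seteqP; split => t /=; rewrite /half_space /= mxE in_itv/= andbT.
Qed.
Let mD := measurable_half_space.

Lemma near_half_space x : half_space x -> \forall y \near x, half_space y.
Proof.
move=> x0.
have H : (fun y : V => y 0 ord_max) @ x --> x 0 ord_max.
  exact: component_continuous.
exact: (cvgr_gt _ H _ x0).
Qed.

Lemma measurable_half_space_fun f :
  (forall x, half_space x -> {for x, continuous f}) ->
  measurable_fun D (fun t => (f (row_of_tuple t))%:E).
Proof. by move=> cf; apply/measurable_EFinP; exact: measurable_continuous_on. Qed.

(** Integrable functions have a finite integral, and the manipulations of
    integrals below are linear algebra and inequalities in [R]. *)
Definition half_space_fine_integral f : R := fine (half_space_integral f).
Local Notation I := half_space_fine_integral.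

Lemma half_space_integralE f : half_space_integrable f ->
  half_space_integral f = (I f)%:E.
Proof. by move=> fi; rewrite /I fineK//; exact: integrable_fin_num. Qed.

Lemma eq_half_space_integrable f g : (forall x, half_space x -> f x = g x) ->
  half_space_integrable f -> half_space_integrable g.
Proof.
move=> fg; apply: eq_integrable => // t /[!inE] tD.
by rewrite fg.
Qed.

Lemma eq_half_space_integral f g : (forall x, half_space x -> f x = g x) ->
  half_space_integral f = half_space_integral g.
Proof. by move=> fg; apply: eq_integral => t /[!inE] tD; rewrite fg. Qed.

Lemma half_space_integrable_le f g :
  (forall x, half_space x -> {for x, continuous f}) ->
  (forall x, half_space x -> `|f x| <= g x) ->
  half_space_integrable g -> half_space_integrable f.
Proof.
move=> cf fg; apply: le_integrable => //; first exact: measurable_half_space_fun.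
by move=> t tD; rewrite /= lee_fin (le_trans (fg _ tD))// ler_norm.
Qed.

Lemma half_space_integrableD f g : half_space_integrable f ->
  half_space_integrable g -> half_space_integrable (fun x => f x + g x).
Proof.
move=> fi gi; rewrite /half_space_integrable.
by under eq_fun do rewrite EFinD; exact: integrableD.
Qed.

Lemma half_space_integrableZ (a : R) f : half_space_integrable f ->
  half_space_integrable (fun x => a * f x).
Proof.
move=> fi; rewrite /half_space_integrable.
by under eq_fun do rewrite EFinM; exact: integrableZl.
Qed.

Lemma half_space_integrable_norm f : half_space_integrable f ->
  half_space_integrable (fun x => `|f x|).
Proof. by move=> fi; exact: integrable_norm. Qed.

Lemma half_space_integrable_sum (J : Type) (r : seq J) (f : J -> V -> R) :
  (forall j, half_space_integrable (f j)) ->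
  half_space_integrable (fun x => \sum_(j <- r) f j x).
Proof.
move=> fi; rewrite /half_space_integrable.
under eq_fun do rewrite -sumEFin.
by apply: integrable_sum => // j _; exact: fi.
Qed.

Lemma half_space_integralD f g : half_space_integrable f ->
  half_space_integrable g -> I (fun x => f x + g x) = I f + I g.
Proof.
move=> fi gi; apply: EFin_inj; rewrite EFinD -!half_space_integralE//; last first.
  exact: half_space_integrableD.
by rewrite /half_space_integral -integralD.
Qed.

Lemma half_space_integralZ (a : R) f : half_space_integrable f ->
  I (fun x => a * f x) = a * I f.
Proof.
move=> fi; apply: EFin_inj; rewrite EFinM -!half_space_integralE//; last first.
  exact: half_space_integrableZ.
by rewrite /half_space_integral -integralZl.
Qed.

Lemma half_space_integral_sum (J : Type) (r : seq J) (f : J -> V -> R) :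
  (forall j, half_space_integrable (f j)) ->
  I (fun x => \sum_(j <- r) f j x) = \sum_(j <- r) I (f j).
Proof.
move=> fi; elim: r => [|j r IH].
  rewrite big_nil /I /half_space_integral.
  by under eq_integral do rewrite big_nil; rewrite integral0.
rewrite big_cons -IH -half_space_integralD//; last exact: half_space_integrable_sum.
by congr (fine _); apply: eq_half_space_integral => x _; rewrite big_cons.
Qed.

Lemma half_space_integral_le f g : half_space_integrable f ->
  half_space_integrable g -> (forall x, half_space x -> f x <= g x) ->
  I f <= I g.
Proof.
move=> fi gi fg; rewrite -lee_fin -!half_space_integralE//.
by apply: le_integral => // t /[!inE] tD; rewrite lee_fin fg.
Qed.

Lemma half_space_integral_norm_le f g : half_space_integrable f ->
  half_space_integrable g -> (forall x, half_space x -> `|f x| <= g x) ->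
  `|I f| <= I g.
Proof.
move=> fi gi fg; rewrite ler_norml; apply/andP; split.
  rewrite -mulN1r -half_space_integralZ//; apply: half_space_integral_le => //.
    exact: half_space_integrableZ.
  by move=> x /fg; rewrite mulN1r ler_norml => /andP[].
apply: half_space_integral_le => // x /fg.
by rewrite ler_norml => /andP[].
Qed.

End half_space_integral_theory.

(** * The divergence theorem in the half-space *)

Section divergence_theorem.
Context {R : realType} {n : nat}.
Local Notation V := 'rV[R]_n.+1.
Local Notation T := (n.+1.-tuple (measurableTypeR R)).
Local Notation I := half_space_fine_integral.
Variable G : 'I_n.+1 -> V -> R.
Hypothesis G_derivable : forall i (x : V), half_space x ->
  derivable (G i) x (basis_vector i).
Hypothesis G_continuous : forall i (x : V), half_space x -> {for x, continuous (G i)}.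
Hypothesis partial_G_continuous : forall i (x : V), half_space x ->
  {for x, continuous (partial i (G i))}.
Hypothesis G_integrable : forall i, half_space_integrable (G i).

Let W (x : V) : R := \sum_i partial i (G i) x.
Hypothesis W_integrable : half_space_integrable W.

(** The normal component tends to zero at the boundary, uniformly on bounded
    sets. *)
Hypothesis flux : forall r delta : R, 0 < r -> 0 < delta ->
  exists2 eps : R, 0 < eps & forall x : V, (forall k, `|x 0 k| <= r) ->
    0 < x 0 ord_max <= 2 * eps -> `|G ord_max x| <= delta.

Section cut.
Variables r eps : R.
Hypothesis r0 : 0 < r.
Hypothesis eps0 : 0 < eps.

(** The cutoff vanishes for [x 0 ord_max <= eps], so [F i] has a continuous
    derivative in direction [i] on the whole space, namely [H i], whatever the
    values of [G] outside the half-space. *)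
Let F i (x : V) : R := cutoff r eps x * G i x.

Let H i (x : V) : R :=
  cutoff r eps x * partial i (G i) x + cutoff_partial r eps i x * G i x.

Lemma cutoff_near_boundary (x : V) : x 0 ord_max <= eps -> cutoff r eps x = 0.
Proof. by move=> xe; rewrite /cutoff layer_cutoff_near// mulr0. Qed.

Lemma cutoff_partial_near_boundary i (x : V) : x 0 ord_max <= eps ->
  cutoff_partial r eps i x = 0.
Proof.
move=> xe; rewrite /cutoff_partial layer_cutoff_near//.
by rewrite layer_cutoff_derivative_near// if_same !mulr0 addr0.
Qed.

Let H_low i (x : V) : x 0 ord_max <= eps -> H i x = 0.
Proof.
by move=> xe; rewrite /H cutoff_near_boundary// cutoff_partial_near_boundary// !mul0r addr0.
Qed.

Let near_low (x : V) : x 0 ord_max < eps -> \forall y \near x, (y : V) 0 ord_max <= eps.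
Proof.
move=> xe.
have cx : (fun y : V => y 0 ord_max) @ x --> x 0 ord_max.
  exact: component_continuous.
by near=> y; apply: ltW; near: y; exact: (cvgr_lt _ cx _ xe).
Unshelve. all: by end_near. Qed.

Let is_derive_F i (x : V) : is_derive x (basis_vector i) (F i) (H i x).
Proof.
have [x0|x0] := ltP 0 (x 0 ord_max).
  have d1 := is_derive_cutoff i x (lt0r_neq0 r0) (lt0r_neq0 eps0).
  have d2 := derivableP (G_derivable (i := i) x0).
  apply: (is_derive_eq (is_deriveM d1 d2)).
  have scE (a b : R) : a *: b = a * b by [].
  by rewrite !scE /H addrC (mulrC (G i x)) addrC.
have xe : x 0 ord_max < eps by exact: le_lt_trans x0 eps0.
rewrite H_low ?ltW//.
have cst0 := is_derive_cst (0 : R) x (basis_vector i).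
apply: (near_eq_is_derive _ cst0).
near=> y; rewrite /F cutoff_near_boundary ?mul0r//=.
by near: y; exact: near_low.
Unshelve. all: by end_near. Qed.

Let H_continuous i : continuous (H i).
Proof.
move=> x; have [x0|x0] := ltP 0 (x 0 ord_max).
  apply: continuous_atD; apply: continuous_atM.
  - exact: cutoff_continuous.
  - exact: partial_G_continuous.
  - exact: cutoff_partial_continuous.
  - exact: G_continuous.
have xe : x 0 ord_max < eps by exact: le_lt_trans x0 eps0.
have E : \forall y \near x, H i y = 0.
  by near=> y; apply: H_low; near: y; exact: near_low.
have H0 : H i @ x --> (0 : R) by refine (@cvg_near_cst _ _ _ _ (nbhs x) _ E).
by have e0 := H_low i (ltW xe); rewrite /continuous_at e0.
Unshelve. all: by end_near. Qed.

Let partialF i : partial i (F i) = H i.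
Proof. by apply/funext => x; apply: derive_val. Qed.

Let F_out i (x : V) k : r < `|x 0 k| -> F i x = 0.
Proof. by move=> rx; rewrite /F (cutoff_out eps r0 rx) mul0r. Qed.

Let H_patch i : (fun t : T => (H i (row_of_tuple t))%:E) =
  (fun t : T => (H i (row_of_tuple t))%:E) \_ (row_of_tuple @^-1` half_space).
Proof.
apply/funext => t; rewrite patchE; case: ifPn => //.
move/negP; rewrite inE => /negP; rewrite -leNgt => t0.
by rewrite H_low// (le_trans t0)// ltW.
Qed.

Let integrable_H i : half_space_integrable (H i).
Proof.
apply/(integrable_mkcond _ (@measurable_half_space R n)); rewrite -H_patch.
rewrite -partialF; apply: (integrable_partial_compact (r := r)) => //.
- by rewrite partialF; exact: H_continuous.
- exact: F_out.
Qed.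

Let integral_H_eq0 i : I (H i) = 0.
Proof.
rewrite /I /half_space_integral integral_mkcond -H_patch -partialF.
rewrite (integral_partial_compact r0)//.
- by move=> x; have [] := is_derive_F i x.
- by rewrite partialF; exact: H_continuous.
- exact: F_out.
Qed.

(** The radial factor contributes [4 / r] in all directions; the layer factor
    contributes only to the normal derivative. *)
Lemma cutoff_partial_le i (x : V) : `|cutoff_partial r eps i x| <=
  4 / r + (if i == ord_max then
    radial_cutoff r x * layer_cutoff_derivative eps (x 0 ord_max) else 0).
Proof.
rewrite /cutoff_partial; apply: (le_trans (ler_normD _ _)).
rewrite (normrM (radial_cutoff_partial _ _ _)) (normrM (radial_cutoff _ _)).
rewrite (ger0_norm (layer_cutoff_ge0 _ _)) (ger0_norm (radial_cutoff_ge0 _ _)).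
apply: lerD.
  rewrite -[leRHS]mulr1; apply: ler_pM; rewrite ?layer_cutoff_ge0//.
    exact: radial_cutoff_partial_le.
  exact: layer_cutoff_le1.
case: ifPn => _; last by rewrite normr0 mulr0.
by rewrite ger0_norm// layer_cutoff_derivative_ge0.
Qed.

Let cutoff_partial_bound i (x : V) :
  `|cutoff_partial r eps i x| <= 4 / r + 4 / eps.
Proof.
apply: (le_trans (cutoff_partial_le _ _)); rewrite lerD2l.
case: ifPn => _; last by rewrite divr_ge0// ltW.
rewrite -[leRHS]mul1r ler_pM ?radial_cutoff_ge0 ?radial_cutoff_le1//.
  exact: layer_cutoff_derivative_ge0.
exact: layer_cutoff_derivative_le.
Qed.

Let integrable_cutoff_partial_G i : half_space_integrable (fun x => cutoff_partial r eps i x * G i x).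
Proof.
apply: (@half_space_integrable_le _ _ _
    (fun x => (4 / r + 4 / eps) * `|G i x|)).
- by move=> x x0; apply: continuous_atM; [exact: cutoff_partial_continuous|exact: G_continuous].
- by move=> x x0; rewrite normrM ler_wpM2r.
- by apply: half_space_integrableZ; exact: half_space_integrable_norm.
Qed.

Lemma cutoff_ge0 (x : V) : 0 <= cutoff r eps x.
Proof. by rewrite mulr_ge0 ?radial_cutoff_ge0 ?layer_cutoff_ge0. Qed.

Lemma cutoff_le1 (x : V) : cutoff r eps x <= 1.
Proof.
by rewrite mulr_ile1 ?radial_cutoff_ge0 ?layer_cutoff_ge0
  ?radial_cutoff_le1 ?layer_cutoff_le1.
Qed.

Let W_continuous (x : V) : half_space x -> {for x, continuous W}.
Proof. by move=> x0; apply: continuous_at_sum => i _; exact: partial_G_continuous. Qed.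

Let integrable_cutoff_W : half_space_integrable (fun x => cutoff r eps x * W x).
Proof.
apply: (@half_space_integrable_le _ _ _ (fun x => `|W x|)).
- by move=> x x0; apply: continuous_atM; [exact: cutoff_continuous|exact: W_continuous].
- move=> x x0; rewrite normrM ler_piMl// ger0_norm ?cutoff_ge0//.
  exact: cutoff_le1.
- exact: half_space_integrable_norm.
Qed.

(** Integration by parts: the boundary does not contribute because the field
    multiplied by the cutoff has compact support in the open half-space. *)
Lemma integral_cutoff_divergence :
  I (fun x => cutoff r eps x * W x) =
  - I (fun x => \sum_i cutoff_partial r eps i x * G i x).
Proof.
apply/eqP; rewrite -addr_eq0 -half_space_integralD//; last first.
  exact: half_space_integrable_sum.
rewrite (_ : (fun x => _) = (fun x => \sum_i H i x)); last first.
  by apply/funext => x; rewrite mulr_sumr -big_split.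
by rewrite half_space_integral_sum// big1.
Qed.

(** The box that contains the part of the support of the cutoff where the layer
    factor is not constant. *)
Let low (k : 'I_n.+1) : R := if k == ord_max then 0 else - r.
Let high (k : 'I_n.+1) : R := if k == ord_max then 2 * eps else r.

Definition layer_indicator (x : V) : R :=
  if [forall k, low k <= x 0 k <= high k] then 1 else 0.

Let layer_volume :
  (lebesgue_tuple n.+1 (tuple_box low high) = ((2 * r) ^+ n * (2 * eps))%:E)%E.
Proof.
rewrite lebesgue_tuple_box; last first.
  move=> k; rewrite /low /high; case: ifPn => _.
    by rewrite mulr_ge0// ltW.
  by rewrite (@le_trans _ _ 0) ?oppr_le0 ?ltW.
congr (_%:E); rewrite big_ord_recr /low /high /= eqxx subr0; congr (_ * _).
rewrite (eq_bigr (fun=> 2 * r)); first by rewrite prodr_const card_ord.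
move=> k _; have -> : (widen_ord (leqnSn n) k == ord_max) = false.
  by rewrite -val_eqE /= ltn_eqF.
by rewrite opprK mulr2n mulrDl mul1r.
Qed.

Let layer_indicatorE (t : T) : ((layer_indicator (row_of_tuple t))%:E =
  (\1_(tuple_box low high) t)%:E)%E.
Proof.
rewrite /layer_indicator indicE; congr (_%:E).
rewrite (_ : [forall k, _] = (t \in tuple_box low high)); first by case: ifP.
apply/forallP/idP => [tb|/[!inE] tb k].
  by rewrite inE => k; have := tb k; rewrite mxE.
by rewrite mxE.
Qed.

Let integral_layer_indicator :
  (half_space_integral layer_indicator <= ((2 * r) ^+ n * (2 * eps))%:E)%E.
Proof.
have mB : measurable (tuple_box low high) by exact: measurable_tuple_box.
rewrite /half_space_integral; under eq_integral do rewrite layer_indicatorE.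
rewrite integral_indic//; last exact: measurable_half_space.
rewrite -layer_volume; apply: le_measure; rewrite ?inE//.
by apply: measurableI => //; exact: measurable_half_space.
Qed.

Let integrable_layer_indicator : half_space_integrable layer_indicator.
Proof.
have mB : measurable (tuple_box low high) by exact: measurable_tuple_box.
rewrite /half_space_integrable; under eq_fun do rewrite layer_indicatorE.
apply/integrableP; split; first exact/measurable_EFinP.
apply: le_lt_trans (ltry ((2 * r) ^+ n * (2 * eps))).
apply: le_trans integral_layer_indicator.
rewrite le_eqVlt; apply/orP; left; apply/eqP.
apply: eq_integral => t _; rewrite layer_indicatorE gee0_abs// lee_fin.
Qed.

Variable delta : R.
Hypothesis delta0 : 0 < delta.
Hypothesis small : forall x : V, (forall k, `|x 0 k| <= r) ->
  0 < x 0 ord_max <= 2 * eps -> `|G ord_max x| <= delta.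

Let layer_bound (x : V) : half_space x ->
  radial_cutoff r x * layer_cutoff_derivative eps (x 0 ord_max)
    * `|G ord_max x| <= 4 / eps * delta * layer_indicator x.
Proof.
move=> x0.
have rhs0 : 0 <= 4 / eps * delta * layer_indicator x.
  apply: mulr_ge0; last by rewrite /layer_indicator; case: ifP.
  by rewrite mulr_ge0 ?divr_ge0 ?(ltW eps0) ?(ltW delta0).
have [xe|xe] := leP (2 * eps) (x 0 ord_max).
  by rewrite layer_cutoff_derivative_far// mulr0 mul0r.
have [/forallP xr|/forallPn[k]] := boolP [forall k, `|x 0 k| <= r]; last first.
  rewrite -ltNge => xk; rewrite /radial_cutoff /pos_sqr.
  by rewrite (radial_cutoff_out r0 xk) expr0n !mul0r.
rewrite /layer_indicator ifT.
  have d0 := layer_cutoff_derivative_ge0 (x 0 ord_max) eps0.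
  rewrite mulr1; apply: ler_pM => //.
  - by rewrite mulr_ge0 ?radial_cutoff_ge0.
  - rewrite -[leRHS]mul1r; apply: ler_pM => //.
    + exact: radial_cutoff_ge0.
    + exact: radial_cutoff_le1.
    + exact: layer_cutoff_derivative_le.
  - by apply: small => //; apply/andP; split => //; exact: ltW.
apply/forallP => k; rewrite /low /high; case: eqVneq => [->|_].
  by apply/andP; split; exact: ltW.
by rewrite -ler_norml.
Qed.

(** The layer has volume [(2 * r) ^+ n * (2 * eps)], on which the derivative of
    the layer factor is at most [4 / eps] and the normal component of [G] at
    most [delta]: the powers of [eps] cancel. *)
Lemma cutoff_divergence_bound :
  `|I (fun x => cutoff r eps x * W x)| <=
  4 / r * (\sum_i I (fun x => `|G i x|)) + 8 * delta * (2 * r) ^+ n.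
Proof.
have iN i := half_space_integrable_norm (G_integrable i).
have iS : half_space_integrable (fun x => 4 / r * \sum_i `|G i x|).
  by apply: half_space_integrableZ; exact: half_space_integrable_sum.
have iL := half_space_integrableZ (4 / eps * delta) integrable_layer_indicator.
rewrite integral_cutoff_divergence normrN.
apply: (@le_trans _ _ (I (fun x => 4 / r * (\sum_i `|G i x|) +
    4 / eps * delta * layer_indicator x))).
  apply: half_space_integral_norm_le.
  - exact: half_space_integrable_sum.
  - exact: half_space_integrableD.
  move=> x x0; apply: (le_trans (ler_norm_sum _ _ _)).
  apply: (@le_trans _ _ (\sum_i (4 / r * `|G i x| +
     (if i == ord_max then radial_cutoff r x *
        layer_cutoff_derivative eps (x 0 ord_max) * `|G i x| else 0)))).
    apply: ler_sum => i _; rewrite normrM.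
    apply: (le_trans (ler_wpM2r (normr_ge0 _) (cutoff_partial_le i x))).
    by rewrite mulrDl; case: ifP => _ //; rewrite mul0r.
  rewrite big_split /= -mulr_sumr lerD2l -big_mkcond big_pred1_eq.
  exact: layer_bound.
rewrite half_space_integralD// half_space_integralZ ?half_space_integral_sum//;
  last exact: half_space_integrable_sum.
rewrite lerD2l half_space_integralZ//.
have := integral_layer_indicator.
rewrite half_space_integralE// lee_fin => Lv.
have ed0 : 0 <= 4 / eps * delta by rewrite mulr_ge0 ?divr_ge0 ?ltW.
apply: (le_trans (ler_wpM2l ed0 Lv)).
rewrite le_eqVlt; apply/orP; left; apply/eqP; field.
by rewrite gt_eqF.
Qed.

End cut.

Lemma cutoff_cvg (r eps : nat -> R) (x : V) : half_space x ->
  (forall m, r m = m.+1%:R) -> (forall m, 0 < eps m <= m.+1%:R^-1) ->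
  cutoff (r m) (eps m) x @[m --> \oo] --> (1 : R).
Proof.
move=> x0 rE epsE.
have rinv : (m.+1%:R^-1 : R) @[m --> \oo] --> (0 : R) by exact: cvg_harmonic.
have c1 : 1 - sqr_norm x * (m.+1%:R^-1 * m.+1%:R^-1) @[m --> \oo] --> (1 : R).
  rewrite -[X in _ --> X]subr0; apply: cvgB; first exact: cvg_cst.
  rewrite -(mulr0 (sqr_norm x)); apply: cvgM; first exact: cvg_cst.
  by rewrite -(mulr0 (0 : R)); apply: cvgM.
have c2 : radial_cutoff (r m) x @[m --> \oo] --> (1 : R).
  rewrite (_ : 1 = pos_sqr 1); last by rewrite /pos_sqr pos_part_id ?expr1n.
  rewrite (_ : (fun m => _) =
    pos_sqr \o (fun m => 1 - sqr_norm x * (m.+1%:R^-1 * m.+1%:R^-1))).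
    by apply: continuous_cvg => //; exact: pos_sqr_continuous.
  by apply/funext => m; rewrite /radial_cutoff /= rE expr2 invfM.
have c3 : layer_cutoff (eps m) (x 0 ord_max) @[m --> \oo] --> (1 : R).
  have x2 : 0 < x 0 ord_max / 2 by rewrite divr_gt0.
  apply: cvg_near_cst; near=> m.
  have /andP[e0 em] := epsE m.
  apply: layer_cutoff_far => //.
  rewrite mulrC -ler_pdivlMr//; apply: (le_trans em).
  by apply: ltW; near: m; exact: (near_infty_natSinv_lt (PosNum x2)).
rewrite -[X in _ --> X]mulr1.
exact: cvgM c2 c3.
Unshelve. all: by end_near. Qed.

(** With [r = m.+1] the contribution of the layer is made at most [1 / m.+1] by
    the choice of [delta], and then [eps] is taken small enough for that
    [delta] and at most [1 / m.+1], so that the cutoffs tend to 1 at every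
    point of the half-space. The individual [partial i (G i)] need not be
    integrable: dominated convergence applies to their sum. *)
Theorem half_space_divergence : half_space_integral W = 0%E.
Proof.
pose A := \sum_i I (fun x => `|G i x|).
pose r m : R := m.+1%:R.
pose delta m : R := (8 * (2 * r m) ^+ n * r m)^-1.
have r0 m : 0 < r m by [].
have delta0 m : 0 < delta m.
  by rewrite invr_gt0 !mulr_gt0// exprn_gt0// mulr_gt0.
have epsP m : {eps : R | 0 < eps <= (r m)^-1 &
    forall x : V, (forall k, `|x 0 k| <= r m) ->
    0 < x 0 ord_max <= 2 * eps -> `|G ord_max x| <= delta m}.
  apply: cid2; have [eps eps0 small] := flux (r0 m) (delta0 m).
  exists (Num.min eps (r m)^-1).
    by rewrite lt_min eps0 invr_gt0 r0 ge_min lexx orbT.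
  move=> x xr /andP[x0 xe]; apply: small => //; rewrite x0 (le_trans xe)//.
  by rewrite ler_pM2l// ge_min lexx.
pose eps m := s2val (epsP m).
have epsE m : 0 < eps m <= (r m)^-1 by exact: (s2valP (epsP m)).
have eps0 m : 0 < eps m by have /andP[] := epsE m.
have small m := s2valP' (epsP m).
pose f m (x : V) : R := cutoff (r m) (eps m) x * W x.
have W_continuous (x : V) : half_space x -> {for x, continuous W}.
  by move=> x0; apply: continuous_at_sum => i _; exact: partial_G_continuous.
have fi m : half_space_integrable (f m).
  apply: (@half_space_integrable_le _ _ _ (fun x => `|W x|)).
  - by move=> x x0; apply: continuous_atM; [exact: cutoff_continuous|exact: W_continuous].
  - move=> x x0; rewrite normrM ler_piMl// ger0_norm ?cutoff_ge0//.
    exact: cutoff_le1.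
  - exact: half_space_integrable_norm.
have fbound m : `|I (f m)| <= (4 * A + 1) * m.+1%:R^-1.
  apply: (le_trans (cutoff_divergence_bound (r0 m) (eps0 m) (delta0 m) (small m))).
  have -> : 8 * delta m * (2 * r m) ^+ n = (r m)^-1.
    by rewrite /delta; field; rewrite !gt_eqF// exprn_gt0// mulr_gt0.
  rewrite -/A -/(r m) le_eqVlt; apply/orP; left; apply/eqP; ring.
have lim0 : (half_space_integral (f m) @[m --> \oo] --> 0)%E.
  under eq_fun do rewrite half_space_integralE//.
  apply: cvg_EFin; first by near=> m.
  apply: (@squeeze_cvgr _ _ _ _ (fun m => - ((4 * A + 1) * m.+1%:R^-1))
    (fun m => (4 * A + 1) * m.+1%:R^-1)).
  - by near=> m; rewrite -ler_norml /=; exact: fbound.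
  - rewrite -oppr0 -(mulr0 (4 * A + 1)); apply: cvgN; apply: cvgM.
      exact: cvg_cst.
    exact: cvg_harmonic.
  - rewrite -(mulr0 (4 * A + 1)); apply: cvgM; first exact: cvg_cst.
    exact: cvg_harmonic.
have [|||_ _ DC] := @dominated_convergence _ T R (lebesgue_tuple n.+1)
  ((@row_of_tuple R n) @^-1` half_space) (@measurable_half_space R n)
  (fun m t => (f m (row_of_tuple t))%:E) (fun t => (W (row_of_tuple t))%:E)
  (fun t => `|W (row_of_tuple t)|%:E)
  (fun m => measurable_int _ (fi m)) (measurable_int _ W_integrable).
- apply: aeW => t tD; apply: cvg_EFin; first by near=> m.
  rewrite /= -[W _]mul1r.
  apply: cvgM; last exact: cvg_cst.
  exact: cutoff_cvg.
- exact: half_space_integrable_norm.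
- apply: aeW => t m tD; rewrite lee_fin /f normrM ler_piMl//.
  by rewrite ger0_norm ?cutoff_ge0// cutoff_le1.
- exact: (cvg_unique _ DC lim0).
Unshelve. all: by end_near. Qed.

End divergence_theorem.

(** * Mean values and the symmetry of second derivatives *)

Section mean_value.
Context {R : realType}.

Lemma is_derive_translate (W : normedModType R) (f : W -> R) (a x v : W) (d : R) :
  is_derive (x + a) v f d -> is_derive x v (fun y => f (y + a)) d.
Proof.
have E : (fun h : R => h^-1 *: (((fun y => f (y + a)) \o shift x) (h *: v) -
      f (x + a))) =
    (fun h => h^-1 *: ((f \o shift (x + a)) (h *: v) - f (x + a))).
  by apply/funext => h; rewrite /= addrA.
by move=> [d1 d2]; split; move: d1 d2; rewrite /derivable /derive E.
Qed.

Lemma MVT_line (W : normedModType R) (f : W -> R) (x v : W) (h : R) : 0 < h ->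
  (forall s, 0 < s < h -> derivable f (x + s *: v) v) ->
  {within `[0, h], continuous (fun s : R => f (x + s *: v))} ->
  exists2 c, 0 < c < h & f (x + h *: v) - f x = 'D_v f (x + c *: v) * h.
Proof.
move=> h0 df cf.
have [|c ch] := @MVT _ (fun s => f (x + s *: v)) (fun s => 'D_v f (x + s *: v))
    0 h h0 _ cf.
  move=> s; rewrite in_itv/= => sh.
  exact: (is_derive_line (df s sh)).
rewrite scale0r addr0 subr0 => E; exists c => //.
Qed.

Lemma MVT_line_derivable (W : normedModType R) (f : W -> R) (x v : W) (h : R) : 0 < h ->
  (forall s, 0 <= s <= h -> derivable f (x + s *: v) v) ->
  exists2 c, 0 < c < h & f (x + h *: v) - f x = 'D_v f (x + c *: v) * h.
Proof.
move=> h0 df; apply: MVT_line => //.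
  by move=> s /andP[s0 sh]; apply: df; rewrite !ltW.
apply: derivable_within_continuous => s; rewrite in_itv/= => sh.
by have [] := is_derive_line (df s sh).
Qed.

End mean_value.

Section schwarz.
Context {R : realType} {n : nat}.
Local Notation V := 'rV[R]_n.+1.

(** The difference in direction [k] of the difference of [f] in direction [i]
    is evaluated by two applications of the mean value theorem. *)
Lemma second_difference (f : V -> R) (i k : 'I_n.+1) (x : V) (h : R) : 0 < h ->
  (forall s r, 0 <= s <= h -> 0 <= r <= h ->
    let y := x + r *: basis_vector k + s *: basis_vector i in
    derivable f y (basis_vector k) /\
    derivable (partial k f) y (basis_vector i)) ->
  exists s r y, [/\ 0 <= s <= h, 0 <= r <= h,
    y = x + r *: basis_vector k + s *: basis_vector i &
    f (x + h *: basis_vector k + h *: basis_vector i)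
      - f (x + h *: basis_vector k) - (f (x + h *: basis_vector i) - f x) =
    partial i (partial k f) y * h * h].
Proof.
move=> h0 df.
have hh : 0 <= h <= h by rewrite lexx ltW.
have h00 : 0 <= (0 : R) <= h by rewrite lexx ltW.
pose g (y : V) := f (y + h *: basis_vector i) - f y.
have dg r : 0 <= r <= h -> is_derive (x + r *: basis_vector k) (basis_vector k) g
    (partial k f (x + r *: basis_vector k + h *: basis_vector i)
      - partial k f (x + r *: basis_vector k)).
  move=> rh; apply: is_deriveB.
    apply: is_derive_translate; apply: derivableP.
    exact: (df h r hh rh).1.
  apply: derivableP.
  by have [] := df 0 r h00 rh; rewrite scale0r addr0.
have [r rh Dg] := @MVT_line_derivable _ _ g x (basis_vector k) h h0
  (fun r rh => ex_derive (is_derive := dg r rh)).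
have rh' : 0 <= r <= h by case/andP: rh => ? ?; rewrite !ltW.
have [s sh Ds] := @MVT_line_derivable _ _ (partial k f) (x + r *: basis_vector k)
  (basis_vector i) h h0 (fun s sh => (df s r sh rh').2).
exists s, r, (x + r *: basis_vector k + s *: basis_vector i); split => //.
  by case/andP: sh => ? ?; rewrite !ltW.
transitivity (g (x + h *: basis_vector k) - g x); first by [].
rewrite Dg (@derive_val _ _ _ _ _ _ _ (dg r rh')) Ds; congr (_ * _ * _).
Qed.

Lemma norm_basis_vector (k : 'I_n.+1) (s : R) :
  `|s *: basis_vector k| <= `|s| :> R.
Proof.
rewrite [leLHS]/Num.norm /= mx_normrE; apply: bigmax_le => // -[a b] _ /=.
rewrite /basis_vector !mxE; case: (_ && _); first by rewrite mulr1.
by rewrite mulr0 normr0.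
Qed.

Lemma nbhs_and3 (T : topologicalType) (x : T) (A B C : set T) :
  nbhs x A -> nbhs x B -> nbhs x C -> nbhs x [set y | [/\ A y, B y & C y]].
Proof. by move=> a b c; apply: filterS3 a b c => y ? ? ?; split. Qed.

(** Schwarz's theorem. The second difference is symmetric in [i] and [k], so by
    [second_difference] the two mixed derivatives take equal values at two
    points that are arbitrarily close to [x]; continuity concludes. *)
Lemma partialC (f : V -> R) (i k : 'I_n.+1) (A : set V) (x : V) :
  open A -> A x ->
  (forall j y, A y -> derivable f y (basis_vector j)) ->
  (forall j l y, A y -> derivable (partial j f) y (basis_vector l)) ->
  (forall j l y, A y -> {for y, continuous (partial j (partial l f))}) ->
  partial i (partial k f) x = partial k (partial i f) x.
Proof.
move=> oA Ax df ddf cddf; apply/eqP; rewrite -subr_eq0 -normr_eq0.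
rewrite eq_le normr_ge0 andbT; apply/ler_addgt0Pr => e e0; rewrite add0r.
have e2 : 0 < e / 2 by rewrite divr_gt0.
have nx : \forall y \near x, [/\ A y,
    `|partial i (partial k f) x - partial i (partial k f) y| < e / 2 &
    `|partial k (partial i f) x - partial k (partial i f) y| < e / 2].
  have cik : partial i (partial k f) y @[y --> x] --> partial i (partial k f) x.
    exact: cddf.
  have cki : partial k (partial i f) y @[y --> x] --> partial k (partial i f) x.
    exact: cddf.
  have n1 : \forall y \near x, A y by exact: open_nbhs_nbhs.
  move/cvgrPdist_lt : cik => /(_ _ e2) n2.
  move/cvgrPdist_lt : cki => /(_ _ e2) n3.
  exact: (nbhs_and3 n1 n2 n3).
move/nbhs_ballP : nx => [d /= d0 Hd].
(* Two steps of length at most [d / 3] stay in the ball of radius [d]. *)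
pose h := d / 3.
have h0 : 0 < h by rewrite divr_gt0.
have inA j l s r : 0 <= s <= h -> 0 <= r <= h ->
    ball x d (x + r *: basis_vector j + s *: basis_vector l).
  move=> /andP[s0 sh] /andP[r0 rh]; rewrite -ball_normE /ball_ /=.
  rewrite -addrA opprD addNKr normrN.
  rewrite (le_lt_trans (ler_normD _ _))//.
  rewrite (le_lt_trans (lerD (norm_basis_vector _ _) (norm_basis_vector _ _)))//.
  rewrite !ger0_norm// (le_lt_trans (lerD rh sh))// /h; lra.
have [|s [r [y [sh rh yE E1]]]] := @second_difference f i k x h h0.
  move=> s r sh rh /=; have [Ay _ _] := Hd _ (inA k i s r sh rh).
  by split; [exact: df|exact: ddf].
have [|s' [r' [y' [sh' rh' yE' E2]]]] := @second_difference f k i x h h0.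
  move=> s' r' sh' rh' /=; have [Ay _ _] := Hd _ (inA i k s' r' sh' rh').
  by split; [exact: df|exact: ddf].
have := Hd _ (inA k i s r sh rh); rewrite -yE => -[_ H1 _].
have := Hd _ (inA i k s' r' sh' rh'); rewrite -yE' => -[_ _ H2].
rewrite (addrAC x (h *: basis_vector i)) in E2.
move: E1 E2 H1 H2.
move: (partial i (partial k f) y) (partial k (partial i f) y') => p q.
move: (partial i (partial k f) x) (partial k (partial i f) x) => p0 q0.
move: (f (x + h *: basis_vector k + h *: basis_vector i)) (f x) => f1 f2.
move: (f (x + h *: basis_vector k)) (f (x + h *: basis_vector i)) => f3 f4.
move=> E1 E2 H1 H2.
have hn0 : h != 0 by rewrite gt_eqF.
have E : p = q.
  by apply: (mulIf hn0); apply: (mulIf hn0); rewrite -E1 -E2; ring.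
rewrite (_ : p0 - q0 = (p0 - p) - (q0 - q)); last by rewrite E; ring.
by rewrite (le_trans (ler_normB _ _))// (splitr e) lerD// ltW.
Qed.

End schwarz.

(** * Functions continuous up to the boundary *)

Section closed_half_space_continuity.
Context {R : realType} {n : nat}.
Local Notation V := 'rV[R]_n.+1.
Local Notation C := (@closed_half_space R n).
Implicit Types (f g : V -> R) (x : V).

Lemma within_cst (a : R) : {within C, continuous (fun=> a : R)}.
Proof. by move=> x; exact: cst_continuous. Qed.

Lemma withinD f g : {within C, continuous f} -> {within C, continuous g} ->
  {within C, continuous (fun x => f x + g x : R)}.
Proof. by move=> cf cg x; exact: (continuousD (cf x) (cg x)). Qed.

Lemma withinM f g : {within C, continuous f} -> {within C, continuous g} ->
  {within C, continuous (fun x => f x * g x : R)}.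
Proof. by move=> cf cg x; exact: (continuousM (cf x) (cg x)). Qed.

Lemma within_sum (I : Type) (r : seq I) (P : pred I) (f : I -> V -> R) :
  (forall i, P i -> {within C, continuous (f i)}) ->
  {within C, continuous (fun x => \sum_(i <- r | P i) f i x : R)}.
Proof.
move=> cf x; apply: cvg_big => [|i Pi]; first exact: add_continuous.
exact: cf.
Qed.

Lemma within_comp (p : R -> R) f : continuous p -> {within C, continuous f} ->
  {within C, continuous (fun x => p (f x))}.
Proof.
by move=> cp cf x; exact: (@continuous_comp (subspace C) _ _ f p x (cf x) (cp (f x))).
Qed.

Lemma withinP f x : {within C, continuous f} -> C x ->
  f @ within C (nbhs x) --> f x.
Proof. by move=> /subspace_continuousP cf; exact: cf. Qed.

Lemma within_nbhs f x : half_space x -> {within C, continuous f} ->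
  {for x, continuous f}.
Proof.
move=> x0 cf; have := withinP cf (ltW x0).
have xC : nbhs x C.
  by apply: filterS (near_half_space x0) => y; exact: ltW.
by rewrite within_interior.
Qed.

(** On the compact set of the points with [`|x 0 k| <= r] and [0 <= x 0 ord_max],
    the function [x 0 ord_max + pos_part (delta - `|g x|)] is positive: its
    second term equals [delta] on the boundary. It has a positive minimum, and
    a point of height less than that minimum satisfies [`|g x| < delta]. *)
Lemma small_near_boundary g (r delta : R) :
  {within C, continuous g} -> (forall x, half_space_boundary x -> g x = 0) ->
  0 < r -> 0 < delta ->
  exists2 eps : R, 0 < eps & forall x, (forall k, `|x 0 k| <= r) ->
    0 < x 0 ord_max <= 2 * eps -> `|g x| <= delta.
Proof.
move=> cg g0 r0 delta0.
pose K := [set x : V | forall k,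
  `[(if k == ord_max then 0 else - r), r]%classic (x 0 k)].
have KC : K `<=` C.
  by move=> x /(_ ord_max); rewrite /= eqxx in_itv/= => /andP[].
have cK : compact K.
  apply: (@rV_compact _ _ (fun k => `[(if k == ord_max then 0 else - r), r]%classic)).
  by move=> k; exact: segment_compact.
pose q x := x 0 ord_max + pos_part (delta - `|g x|).
have cq : {within K, continuous q}.
  apply: (continuous_subspaceW KC); apply: withinD.
    by apply: continuous_subspaceT; exact: component_continuous.
  apply: (within_comp (@pos_part_continuous R)).
  apply: withinD; first exact: within_cst.
  apply: (within_comp (p := fun y : R => - y)); first exact: opp_continuous.
  by apply: (within_comp _ cg); exact: norm_continuous.
have K0 : K !=set0.
  exists 0 => k /=; rewrite mxE in_itv/=; case: ifP => _.
    by rewrite lexx ltW.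
  by rewrite oppr_le0 ltW.
have [c /set_mem Kc cmin] := EVT_min_rV K0 cK cq.
have q0 : 0 < q c.
  have := KC _ Kc; rewrite /closed_half_space /= le_eqVlt => /orP[/eqP c0|c0].
    by rewrite /q -c0 add0r (g0 c)// normr0 subr0 pos_part_id// ltW.
  by rewrite ltr_pwDl// pos_part_ge0.
(* Heights up to 2 eps are then at most two thirds of the minimum. *)
exists (q c / 3) => [|x xr /andP[x0 xe]]; first by rewrite divr_gt0.
have Kx : x \in K.
  rewrite inE => k /=; rewrite in_itv/=; have := xr k; rewrite ler_norml.
  by case: eqVneq => [->|_] // /andP[_ ->]; rewrite ltW.
have := cmin x Kx; rewrite {2}/q => qx.
rewrite leNgt; apply/negP => gd; move: qx.
rewrite pos_part_eq0; last by rewrite subr_le0 ltW.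
by move=> qx; lra.
Qed.

End closed_half_space_continuity.

(** * The slip condition for the first derivatives *)

Section boundary_values.
Context {R : realType} {n : nat}.
Local Notation V := 'rV[R]_n.+1.
Local Notation C := (@closed_half_space R n).
Local Notation e_ := (@basis_vector R n).
Implicit Types (f g : V -> R) (x : V).

Lemma within_ball f x (e : R) : {within C, continuous f} -> C x -> 0 < e ->
  exists2 d : R, 0 < d & forall y, C y -> `|x - y| < d -> `|f x - f y| < e.
Proof.
move=> cf Cx e0; have /cvgrPdist_lt/(_ _ e0) := withinP cf Cx.
move=> /nbhs_ballP[d /= d0 Hd]; exists d => // y Cy xy.
by apply: Hd => //; rewrite -ball_normE.
Qed.

Lemma continuous_inner_normal f x (h : R) : {within C, continuous f} ->
  half_space_boundary x ->
  {within `[0, h], continuous (fun s : R => f (x + s *: e_ ord_max))}.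
Proof.
move=> cf x0; have Cs s : 0 <= s -> C (x + s *: e_ ord_max).
  move=> s0; rewrite /closed_half_space /= !mxE (x0 : x 0 ord_max = 0) add0r.
  by rewrite !eqxx mulr1.
apply/subspace_continuousP => s /=; rewrite in_itv/= => /andP[s0 sh].
move=> P /(withinP cf (Cs s s0)) /= HP.
have HQ := @continuous_line R _ x (e_ ord_max) s _ HP.
apply: (@filterS _ _ (nbhs_filter s) _ _ _ HQ) => s' HP'.
rewrite /= in_itv/= => /andP[s'0 _].
by apply: HP'; exact: Cs.
Qed.

Variable v : V -> V.
Hypothesis regular : C2_C1bar v.
Hypothesis slip : slip_boundary_condition v.

Lemma within_component j : {within C, continuous (component v j)}.
Proof.
move=> x; have cv := c1_continuous regular (x := x).
have cj := @component_continuous R n j (v x).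
exact: (@continuous_comp (subspace C) V R v (fun y : V => y 0 j) x cv cj).
Qed.

(** By the mean value theorem, the difference quotient of the slip condition is
    a value of the normal derivative at an interior point close to [x]. *)
Lemma normal_derivative_boundary j g x : j != ord_max ->
  {within C, continuous g} ->
  (forall y, half_space y -> g y = partial ord_max (component v j) y) ->
  half_space_boundary x -> g x = 0.
Proof.
move=> jN cg gE x0; have Cx : C x by rewrite /closed_half_space /= x0.
have [_ /(_ _ jN)/cvgrPdist_lt vj] := slip x0.
apply/eqP; rewrite -normr_eq0 eq_le normr_ge0 andbT.
apply/ler_addgt0Pr => e e0; rewrite add0r.
have e2 : 0 < e / 2 by rewrite divr_gt0.
have [d d0 gd] := within_ball cg Cx e2.
near (0 : R)^'+ => h.
have h0 : 0 < h by near: h; exact: nbhs_right_gt.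
have hd : h < d by near: h; exact: nbhs_right_lt.
have vh : `|0 - h^-1 * (v (x + h *: e_ ord_max) 0 j - v x 0 j)| < e / 2.
  by near: h; exact: vj.
have hs (s : R) : 0 < s -> half_space (x + s *: e_ ord_max).
  move=> s0; rewrite /half_space /= !mxE (x0 : x 0 ord_max = 0) add0r.
  by rewrite !eqxx mulr1.
have [|c /andP[c0 ch] E] := @MVT_line R V (component v j) x (e_ ord_max) h h0 _
    (continuous_inner_normal (h := h) (@within_component j) x0).
  by move=> s /andP[s0 _]; apply: (c1_derivable regular); exact: hs.
have gy : g (x + c *: e_ ord_max) =
    h^-1 * (v (x + h *: e_ ord_max) 0 j - v x 0 j).
  rewrite gE; last exact: hs.
  have hn0 : h != 0 by rewrite gt_eqF.
  by move: E; rewrite /component => ->; rewrite mulrCA mulVf// mulr1.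
move: vh; rewrite -gy sub0r normrN => vh.
have := gd _ (ltW (hs _ c0)).
rewrite opprD addNKr normrN => /(_ _).
have cd : `|c *: e_ ord_max| < d.
  rewrite (le_lt_trans (norm_basis_vector _ _))// gtr0_norm//.
  exact: lt_trans hd.
move=> /(_ cd) gxy.
rewrite -(subrK (g (x + c *: e_ ord_max)) (g x)).
by rewrite (le_trans (ler_normD _ _))// (splitr e) lerD// ltW.
Unshelve. all: by end_near. Qed.

(** The normal component vanishes on the boundary, but its tangential derivative
    is only known inside the half-space: the mean value theorem is applied on a
    segment of fixed length [h] parallel to the boundary, at a height [t] that
    tends to zero. The increment along the segment then tends to zero while its
    mean slope stays close to the boundary value [g x]. *)
Lemma tangential_derivative_boundary k g x : k != ord_max ->
  {within C, continuous g} ->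
  (forall y, half_space y -> g y = partial k (component v ord_max) y) ->
  half_space_boundary x -> g x = 0.
Proof.
move=> kN cg gE x0; have Cx : C x by rewrite /closed_half_space /= x0.
apply/eqP; rewrite -normr_eq0 eq_le normr_ge0 andbT.
apply/ler_addgt0Pr => e e0; rewrite add0r.
have e3 : 0 < e / 3 by rewrite divr_gt0.
have [d d0 gd] := within_ball cg Cx e3.
pose h := d / 2.
have h0 : 0 < h by rewrite divr_gt0.
have xk0 : half_space_boundary (x + h *: e_ k).
  rewrite /half_space_boundary /= !mxE (x0 : x 0 ord_max = 0) add0r.
  by rewrite (eq_sym _ k) (negbTE kN) andbF mulr0.
have Cxk : C (x + h *: e_ k) by rewrite /closed_half_space /= xk0.
have eh : 0 < e / 3 * h by rewrite mulr_gt0.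
have [d1 d10 f1] := within_ball (@within_component ord_max) Cx eh.
have [d2 d20 f2] := within_ball (@within_component ord_max) Cxk eh.
near (0 : R)^'+ => t.
have t0 : 0 < t by near: t; exact: nbhs_right_gt.
have td : t < h by near: t; exact: nbhs_right_lt.
have td1 : t < d1 by near: t; exact: nbhs_right_lt.
have td2 : t < d2 by near: t; exact: nbhs_right_lt.
have hs (s : R) : half_space (x + t *: e_ ord_max + s *: e_ k).
  rewrite /half_space /= !mxE (x0 : x 0 ord_max = 0) add0r.
  by rewrite !eqxx (eq_sym _ k) (negbTE kN) /= mulr1 mulr0 addr0.
have [|c /andP[c0 ch] E] := @MVT_line_derivable R V (component v ord_max)
    (x + t *: e_ ord_max) (e_ k) h h0.
  by move=> s _; apply: (c1_derivable regular); exact: hs.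
have := hs 0; rewrite scale0r addr0 => hs0.
have nt : `|t *: e_ ord_max| <= t.
  by rewrite (le_trans (norm_basis_vector _ _))// gtr0_norm.
have nc : `|c *: e_ k| <= c.
  by rewrite (le_trans (norm_basis_vector _ _))// gtr0_norm.
have F1 : `|component v ord_max (x + t *: e_ ord_max)| < e / 3 * h.
  have := f1 _ (ltW hs0); rewrite opprD addNKr normrN => /(_ (le_lt_trans nt td1)).
  by rewrite /component (slip x0).1 sub0r normrN.
have F2 : `|component v ord_max (x + t *: e_ ord_max + h *: e_ k)| < e / 3 * h.
  have := f2 _ (ltW (hs h)); rewrite (addrAC x (t *: _)) opprD addNKr normrN.
  move=> /(_ (le_lt_trans nt td2)).
  by rewrite /component (slip xk0).1 sub0r normrN.
have Gy : `|g (x + t *: e_ ord_max + c *: e_ k)| <= e / 3 + e / 3.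
  rewrite gE// -(ler_pM2r h0) -{1}(gtr0_norm h0) -normrM.
  rewrite /partial -E mulrDl (le_trans (ler_normB _ _))//.
  by rewrite lerD// ltW.
have := gd _ (ltW (hs c)).
rewrite -addrA opprD addNKr normrN => /(_ _).
have cd : `|t *: e_ ord_max + c *: e_ k| < d.
  rewrite (le_lt_trans (ler_normD _ _))// (splitr d).
  by rewrite (le_lt_trans (lerD nt nc))// ltrD.
move=> /(_ cd); rewrite addrA => gxy.
rewrite -(subrK (g (x + t *: e_ ord_max + c *: e_ k)) (g x)).
rewrite (le_trans (ler_normD _ _))// (le_trans (lerD (ltW gxy) Gy))//.
by rewrite le_eqVlt; apply/orP; left; apply/eqP; field.
Unshelve. all: by end_near. Qed.

End boundary_values.

(** * The algebra of the flux *)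

Section flux_algebra.
Context {R : realType} {n : nat}.
Variables (v : 'I_n.+1 -> R) (a : 'I_n.+1 -> 'I_n.+1 -> R)
  (b : 'I_n.+1 -> 'I_n.+1 -> 'I_n.+1 -> R).
Local Notation N := (@ord_max n).

(** The vector field G, as a function of the values [v] of the velocity and
    [a k j] of the derivatives d_k v_j. Its four terms come, in this order,
    from the transport of |grad v|^2, from the derivatives of v_j along i for
    j < n, from those of v_l along i for l < n with j = n, and from the
    replacement of d_n v_n by the tangential divergence. *)
Definition flux_component (i : 'I_n.+1) : R :=
  2^-1 * (v i * \sum_j \sum_k a k j * a k j)
  + \sum_(j | j != N) \sum_k v j * (a k i * a k j)
  + \sum_(l | l != N) v l * (a l N * a i N)
  - (i != N)%:R * (v i * \sum_k a k N * a k N).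

(** The derivative of [flux_component i] in direction [i] given by the product
    rule, where [b i k j] stands for the second derivative d_i d_k v_j. *)
Definition flux_partial (i : 'I_n.+1) : R :=
  2^-1 * (a i i * (\sum_j \sum_k a k j * a k j)
    + v i * (\sum_j \sum_k (b i k j * a k j + a k j * b i k j)))
  + \sum_(j | j != N) \sum_k (a i j * (a k i * a k j)
      + v j * (b i k i * a k j + a k i * b i k j))
  + \sum_(l | l != N) (a i l * (a l N * a i N)
      + v l * (b i l N * a i N + a l N * b i i N))
  - (i != N)%:R * (a i i * (\sum_k a k N * a k N)
      + v i * (\sum_k (b i k N * a k N + a k N * b i k N))).

(** The terms of [flux_partial] with a second derivative and a tangential
    component of the velocity as an undifferentiated factor, except for those of
    the transport term, which are part of the integrand. *)
Definition flux_error (i : 'I_n.+1) : R :=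
  \sum_(j | j != N) \sum_k v j * (b i k i * a k j + a k i * b i k j)
  + \sum_(l | l != N) v l * (b i l N * a i N + a l N * b i i N)
  - (i != N)%:R * (v i * \sum_k (b i k N * a k N + a k N * b i k N)).

(** The transport term of the flux reproduces the sum with second derivatives,
    because the trace of [a] is zero. In the cubic sum, the index [j] is split
    into [j != N] and [j = N], and in the latter case [i] is split likewise;
    the three parts are the remaining terms of the flux, the last one by
    [a N N = - \sum_(i | i != N) a i i]. *)
Lemma flux_divergence :
  (forall i k j, b i k j = b k i j) -> \sum_i a i i = 0 ->
  \sum_j \sum_k (\sum_i (a k i * a i j + v i * b k i j)) * a k j =
  \sum_i flux_partial i - \sum_i flux_error i.
Proof.
move=> bC a0.
(* The normal derivative of the normal component is traded for tangential ones. *)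
have aN : a N N = - \sum_(i | i != N) a i i.
  by apply/eqP; rewrite -addr_eq0; move: a0; rewrite (bigD1 N)//= => ->.
rewrite -sumrB.
transitivity (\sum_j \sum_k \sum_i a k i * a i j * a k j +
    \sum_i v i * \sum_j \sum_k b i k j * a k j).
  under [X in _ + X]eq_bigr => i _ do
    (rewrite mulr_sumr; under eq_bigr => j _ do rewrite mulr_sumr).
  rewrite [X in _ + X]exchange_big /= -big_split /=; apply: eq_bigr => j _.
  rewrite [X in _ + X]exchange_big /= -big_split /=; apply: eq_bigr => k _.
  rewrite mulr_suml -big_split /=; apply: eq_bigr => i _.
  by rewrite (bC k i j); ring.
transitivity (\sum_i (2^-1 * (a i i * (\sum_j \sum_k a k j * a k j)
    + v i * (\sum_j \sum_k (b i k j * a k j + a k j * b i k j)))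
    + \sum_(j | j != N) \sum_k a i j * (a k i * a k j)
    + \sum_(l | l != N) a i l * (a l N * a i N)
    - (i != N)%:R * (a i i * (\sum_k a k N * a k N)))); last first.
  apply: eq_bigr => i _; rewrite /flux_partial /flux_error.
  under [X in _ = _ + X + _ - _ - _]eq_bigr => j _ do rewrite big_split.
  rewrite !big_split /=; ring.
have transport : \sum_i 2^-1 * (a i i * (\sum_j \sum_k a k j * a k j)
      + v i * (\sum_j \sum_k (b i k j * a k j + a k j * b i k j))) =
    \sum_i v i * \sum_j \sum_k b i k j * a k j.
  rewrite -mulr_sumr big_split /= -mulr_suml a0 mul0r add0r mulr_sumr.
  apply: eq_bigr => i _; rewrite mulrCA; congr (_ * _).
  rewrite mulr_sumr; apply: eq_bigr => j _; rewrite mulr_sumr.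
  by apply: eq_bigr => k _; rewrite (mulrC (a k j)); field.
have tangential_part : \sum_i \sum_(j | j != N) \sum_k a i j * (a k i * a k j)
    = \sum_(j | j != N) \sum_k \sum_i a k i * a i j * a k j.
  rewrite exchange_big /=; apply: eq_bigr => j _.
  rewrite exchange_big /=; apply: eq_bigr => k _.
  by apply: eq_bigr => i _; ring.
have normal_part : \sum_k \sum_i a k i * a i N * a k N =
    \sum_i \sum_(l | l != N) a i l * (a l N * a i N)
    - \sum_i (i != N)%:R * (a i i * (\sum_k a k N * a k N)).
  transitivity (\sum_k ((\sum_(l | l != N) a k l * (a l N * a k N))
      + a N N * (a k N * a k N))).
    apply: eq_bigr => k _; rewrite (bigD1 N)//= addrC; congr (_ + _).
      by apply: eq_bigr => i _; ring.
    by ring.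
  rewrite big_split /=; congr (_ + _).
  rewrite -mulr_sumr aN mulNr; congr (- _).
  rewrite mulr_suml big_mkcond; apply: eq_bigr => i _ /=.
  by case: (i != N); rewrite ?mul1r ?mul0r.
rewrite !big_split /= sumrN transport tangential_part.
by rewrite (bigD1 N)//= normal_part; ring.
Qed.

Variables (A B q : R).
Hypothesis q0 : 0 <= q.
Hypothesis vq : forall j, j != N -> `|v j| <= q.
Hypothesis aA : forall k j, `|a k j| <= A.
Hypothesis bB : forall i k j, `|b i k j| <= B.

Let A0 : 0 <= A. Proof. exact: le_trans (aA N N). Qed.
Let B0 : 0 <= B. Proof. exact: le_trans (bB N N N). Qed.

Let error_term_le j x1 y1 x2 y2 : j != N ->
  `|x1| <= B -> `|y1| <= A -> `|x2| <= A -> `|y2| <= B ->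
  `|v j * (x1 * y1 + x2 * y2)| <= 2 * (q * A * B).
Proof.
move=> jN h1 h2 h3 h4; rewrite normrM.
rewrite (_ : 2 * (q * A * B) = q * (B * A + A * B)); last by ring.
apply: ler_pM => //; first exact: vq.
by rewrite (le_trans (ler_normD _ _))// !normrM lerD// ler_pM.
Qed.

Let ler_norm_sum_cst (P : pred 'I_n.+1) (f : 'I_n.+1 -> R) (c : R) :
  0 <= c -> (forall i, P i -> `|f i| <= c) ->
  `|\sum_(i | P i) f i| <= n.+1%:R * c.
Proof.
move=> c0 fc; apply: (le_trans (ler_norm_sum _ _ _)).
rewrite big_mkcond mulr_natl -[X in _ *+ X]card_ord -sumr_const.
by apply: ler_sum => i _; case: ifPn => // Pi; exact: fc.
Qed.

Lemma flux_error_le i : `|flux_error i| <=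
  (2 * n.+1%:R ^+ 2 + 4 * n.+1%:R) * (q * A * B).
Proof.
have p0 : 0 <= 2 * (q * A * B) by rewrite !mulr_ge0.
rewrite (_ : (_ + _) * _ = n.+1%:R * (n.+1%:R * (2 * (q * A * B)))
  + n.+1%:R * (2 * (q * A * B)) + n.+1%:R * (2 * (q * A * B))); last by ring.
apply: (le_trans (ler_normB _ _)); apply: lerD.
  apply: (le_trans (ler_normD _ _)); apply: lerD.
    apply: ler_norm_sum_cst => [|j jN]; first by rewrite mulr_ge0.
    by apply: ler_norm_sum_cst => // k _; exact: error_term_le.
  by apply: ler_norm_sum_cst => // l lN; exact: error_term_le.
case: (boolP (i != N)) => iN; last by rewrite mul0r normr0 mulr_ge0.
rewrite mul1r mulr_sumr.
by apply: ler_norm_sum_cst => // k _; exact: error_term_le.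
Qed.

Variable w : R.
Hypothesis w0 : 0 <= w.
Hypothesis vw : forall j, `|v j| <= w.
Hypothesis sA : \sum_j \sum_k a k j * a k j = A ^+ 2.

Let flux_term_le j x y : `|x| <= A -> `|y| <= A ->
  `|v j * (x * y)| <= w * A ^+ 2.
Proof. by move=> xA yA; rewrite !normrM expr2 ler_pM// ?mulr_ge0// ler_pM. Qed.

Lemma flux_component_le i : `|flux_component i| <=
  (1 + n.+1%:R ^+ 2 + 2 * n.+1%:R) * (w * A ^+ 2).
Proof.
have p0 : 0 <= w * A ^+ 2 by rewrite mulr_ge0 ?sqr_ge0.
rewrite (_ : (_ + _) * _ = w * A ^+ 2 + n.+1%:R * (n.+1%:R * (w * A ^+ 2))
  + n.+1%:R * (w * A ^+ 2) + n.+1%:R * (w * A ^+ 2)); last by ring.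
apply: (le_trans (ler_normB _ _)); apply: lerD.
  apply: (le_trans (ler_normD _ _)); apply: lerD.
    apply: (le_trans (ler_normD _ _)); apply: lerD.
      have vA : `|v i * A ^+ 2| <= w * A ^+ 2.
        by rewrite normrM (ger0_norm (sqr_ge0 A)) ler_wpM2r ?sqr_ge0.
      rewrite sA normrM ger0_norm ?invr_ge0//; apply: le_trans vA.
      by rewrite ler_piMl// invf_le1// ler1n.
    apply: ler_norm_sum_cst => [|j jN]; first by rewrite mulr_ge0.
    by apply: ler_norm_sum_cst => // k _; exact: flux_term_le.
  by apply: ler_norm_sum_cst => // l lN; exact: flux_term_le.
case: (boolP (i != N)) => iN; last by rewrite mul0r normr0 mulr_ge0.
rewrite mul1r mulr_sumr.
by apply: ler_norm_sum_cst => // k _; exact: flux_term_le.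
Qed.

End flux_algebra.

(** The hypotheses are the slip condition at a boundary point: every product in
    the normal component of the flux has one of these factors. *)
Lemma flux_component_boundary (R : realType) (n : nat) (v : 'I_n.+1 -> R)
    (a : 'I_n.+1 -> 'I_n.+1 -> R) :
  v ord_max = 0 -> (forall k, k != ord_max -> a k ord_max = 0) ->
  (forall j, j != ord_max -> a ord_max j = 0) ->
  flux_component v a ord_max = 0.
Proof.
move=> vN akN aNj; rewrite /flux_component vN mul0r mulr0 add0r eqxx mul0r subr0.
rewrite big1 ?add0r => [|j jN].
  by apply: big1 => l lN; rewrite akN// mul0r mulr0.
apply: big1 => k _; have [->|kN] := eqVneq k ord_max.
  by rewrite (aNj _ jN) !mulr0.
by rewrite akN// mul0r mulr0.
Qed.

(** * The flux field of a velocity *)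

Section partial_derivative_rules.
Context {R : realType} {n : nat}.
Local Notation V := 'rV[R]_n.+1.
Implicit Types (f g : V -> R) (x e : V).

Lemma is_deriveD_fun f g x e (df dg : R) :
  is_derive x e f df -> is_derive x e g dg ->
  is_derive x e (fun y => f y + g y) (df + dg).
Proof. by move=> hf hg; exact: is_deriveD. Qed.

Lemma is_deriveB_fun f g x e (df dg : R) :
  is_derive x e f df -> is_derive x e g dg ->
  is_derive x e (fun y => f y - g y) (df - dg).
Proof. by move=> hf hg; exact: is_deriveB. Qed.

Lemma is_deriveM_fun f g x e (df dg : R) :
  is_derive x e f df -> is_derive x e g dg ->
  is_derive x e (fun y => f y * g y) (df * g x + f x * dg).
Proof.
move=> hf hg; apply: (is_derive_eq (is_deriveM hf hg)).
by rewrite addrC; congr (_ + _); exact: mulrC.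
Qed.

Lemma is_deriveZ_fun (c : R) f x e (df : R) :
  is_derive x e f df -> is_derive x e (fun y => c * f y) (c * df).
Proof. by move=> hf; exact: is_deriveZ. Qed.

Lemma is_derive_sum_fun (P : pred 'I_n.+1) (f : 'I_n.+1 -> V -> R) x e
    (df : 'I_n.+1 -> R) :
  (forall i, P i -> is_derive x e (f i) (df i)) ->
  is_derive x e (fun y => \sum_(i | P i) f i y) (\sum_(i | P i) df i).
Proof.
move=> hf; rewrite big_mkcond.
rewrite (_ : (fun y => _) = \sum_i (if P i then f i else cst 0)); last first.
  apply/funext => y; rewrite fct_sumE big_mkcond.
  by apply: eq_bigr => i _; case: ifP.
by apply: is_derive_sum => i; case: ifPn => [/hf //|_]; exact: is_derive_cst.
Qed.

Lemma near_half_space_continuous f g x : half_space x ->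
  (forall y, half_space y -> f y = g y) ->
  {for x, continuous g} -> {for x, continuous f}.
Proof.
move=> x0 fg cg; rewrite /prop_for /continuous_at (fg _ x0).
have E : \forall y \near x, g y = f y.
  by apply: filterS (near_half_space x0) => y /fg.
exact: cvg_trans (near_eq_cvg E) cg.
Qed.

End partial_derivative_rules.

Section velocity.
Context {R : realType} {n : nat}.
Local Notation V := 'rV[R]_n.+1.
Local Notation N := (@ord_max n).
Variable v : V -> V.
Hypothesis regular : C2_C1bar v.
Hypothesis slip : slip_boundary_condition v.
Hypothesis divergence_free : forall x, half_space x -> divergence v x = 0.

Let a (x : V) k j : R := partial k (component v j) x.
Let b (x : V) i k j : R := partial i (partial k (component v j)) x.

Definition flux_field i (x : V) : R := flux_component (v x 0) (a x) i.

Definition flux_field_error (x : V) : R :=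
  \sum_i flux_error (v x 0) (a x) (b x) i.

Lemma is_derive_velocity (x : V) i j : half_space x ->
  is_derive x (basis_vector i) (fun y : V => v y 0 j) (a x i j).
Proof. by move=> x0; apply: derivableP; exact: (c1_derivable regular). Qed.

Lemma is_derive_gradient (x : V) i k j : half_space x ->
  is_derive x (basis_vector i) (fun y : V => a y k j) (b x i k j).
Proof. by move=> x0; apply: derivableP; exact: (c2_derivable regular). Qed.

Lemma is_derive_flux_field i (x : V) : half_space x ->
  is_derive x (basis_vector i) (flux_field i)
    (flux_partial (v x 0) (a x) (b x) i).
Proof.
move=> x0; have dv j := is_derive_velocity i j x0.
have da k j := is_derive_gradient i k j x0.
apply: is_deriveB_fun; last first.
  apply: is_deriveZ_fun; apply: is_deriveM_fun => //.
  by apply: is_derive_sum_fun => k _; exact: is_deriveM_fun.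
apply: is_deriveD_fun; last first.
  apply: is_derive_sum_fun => l _; apply: is_deriveM_fun => //.
  exact: is_deriveM_fun.
apply: is_deriveD_fun; last first.
  apply: is_derive_sum_fun => j _; apply: is_derive_sum_fun => k _.
  by apply: is_deriveM_fun => //; exact: is_deriveM_fun.
apply: is_deriveZ_fun; apply: is_deriveM_fun => //.
apply: is_derive_sum_fun => j _; apply: is_derive_sum_fun => k _.
exact: is_deriveM_fun.
Qed.

Lemma partial_flux_field i (x : V) : half_space x ->
  partial i (flux_field i) x = flux_partial (v x 0) (a x) (b x) i.
Proof. by move=> x0; have [_ <-] := is_derive_flux_field i x0. Qed.

Lemma partial_convection k j (x : V) : half_space x ->
  partial k (convection v j) x =
  \sum_i (a x k i * a x i j + v x 0 i * b x k i j).
Proof.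
move=> x0; suff [] : is_derive x (basis_vector k) (convection v j)
  (\sum_i (a x k i * a x i j + v x 0 i * b x k i j)) by [].
apply: is_derive_sum_fun => i _; apply: is_deriveM_fun.
  exact: is_derive_velocity.
exact: is_derive_gradient.
Qed.

Lemma open_half_space : open (half_space : set V).
Proof. by rewrite openE => x x0; exact: near_half_space. Qed.

Lemma grad_convection_divergence (x : V) : half_space x ->
  grad_convection_dot_grad v x =
  \sum_i partial i (flux_field i) x - flux_field_error x.
Proof.
move=> x0; under [X in _ = X - _]eq_bigr do rewrite partial_flux_field//.
rewrite /flux_field_error -flux_divergence.
- apply: eq_bigr => j _; apply: eq_bigr => k _.
  by rewrite partial_convection.
- move=> i k j; apply: (@partialC R n (component v j) i k _ x open_half_space x0).
  + by move=> l y y0; exact: (c1_derivable regular).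
  + by move=> l m y y0; exact: (c2_derivable regular).
  + by move=> l m y y0; exact: (c2_continuous regular).
- exact: divergence_free.
Qed.

Lemma velocity_continuous (x : V) j : half_space x ->
  {for x, continuous (fun y => v y 0 j)}.
Proof. by move=> x0; exact: (within_nbhs x0 (within_component regular (j := j))). Qed.

Lemma gradient_continuous (x : V) k j : half_space x ->
  {for x, continuous (fun y => a y k j)}.
Proof.
move=> x0; have [g [cg gE]] := c1_extension regular j k.
apply: (near_half_space_continuous (g := g)) => //.
  by move=> y y0; rewrite gE.
exact: within_nbhs.
Qed.

Lemma hessian_continuous (x : V) i k j : half_space x ->
  {for x, continuous (fun y => b y i k j)}.
Proof. by move=> x0; exact: (c2_continuous regular). Qed.

Lemma flux_field_continuous i (x : V) : half_space x ->
  {for x, continuous (flux_field i)}.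
Proof.
move=> x0; have cv j := @velocity_continuous x j x0.
have ca k j := @gradient_continuous x k j x0.
apply: continuous_atD; last first.
  apply: continuous_atN; apply: continuous_atM; first exact: continuous_at_cst.
  by apply: continuous_atM => //; apply: continuous_at_sum => k _; exact: continuous_atM.
apply: continuous_atD; last first.
  by apply: continuous_at_sum => l _; apply: continuous_atM => //; exact: continuous_atM.
apply: continuous_atD; last first.
  by apply: continuous_at_sum => j _; apply: continuous_at_sum => k _; apply: continuous_atM => //; exact: continuous_atM.
apply: continuous_atM; first exact: continuous_at_cst.
apply: continuous_atM => //; apply: continuous_at_sum => j _; apply: continuous_at_sum => k _; exact: continuous_atM.
Qed.

Lemma partial_flux_field_continuous i (x : V) : half_space x ->
  {for x, continuous (partial i (flux_field i))}.
Proof.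
move=> x0; apply: (near_half_space_continuous
  (g := fun y => flux_partial (v y 0) (a y) (b y) i)) => //.
  by move=> y y0; exact: partial_flux_field.
have cv j := @velocity_continuous x j x0.
have ca k j := @gradient_continuous x k j x0.
have cb l k j := @hessian_continuous x l k j x0.
apply: continuous_atD; last first.
  apply: continuous_atN; apply: continuous_atM; first exact: continuous_at_cst.
  apply: continuous_atD; apply: continuous_atM => //; apply: continuous_at_sum => k _; first exact: continuous_atM.
  by apply: continuous_atD; exact: continuous_atM.
apply: continuous_atD; last first.
  apply: continuous_at_sum => l _; apply: continuous_atD; apply: continuous_atM => //; first exact: continuous_atM.
  by apply: continuous_atD; exact: continuous_atM.
apply: continuous_atD; last first.
  apply: continuous_at_sum => j _; apply: continuous_at_sum => k _.
  apply: continuous_atD; apply: continuous_atM => //; first exact: continuous_atM.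
  by apply: continuous_atD; exact: continuous_atM.
apply: continuous_atM; first exact: continuous_at_cst.
apply: continuous_atD; apply: continuous_atM => //; apply: continuous_at_sum => j _; apply: continuous_at_sum => k _.
  exact: continuous_atM.
by apply: continuous_atD; exact: continuous_atM.
Qed.

Lemma flux_field_error_continuous (x : V) : half_space x ->
  {for x, continuous flux_field_error}.
Proof.
move=> x0; apply: continuous_at_sum => i _.
have cv j := @velocity_continuous x j x0.
have ca k j := @gradient_continuous x k j x0.
have cb l k j := @hessian_continuous x l k j x0.
apply: continuous_atD; last first.
  apply: continuous_atN; apply: continuous_atM; first exact: continuous_at_cst.
  apply: continuous_atM => //; apply: continuous_at_sum => k _.
  by apply: continuous_atD; exact: continuous_atM.
apply: continuous_atD.
  apply: continuous_at_sum => j _; apply: continuous_at_sum => k _; apply: continuous_atM => //.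
  by apply: continuous_atD; exact: continuous_atM.
apply: continuous_at_sum => l _; apply: continuous_atM => //.
by apply: continuous_atD; exact: continuous_atM.
Qed.

End velocity.

(** * Integrability of the flux and the estimate *)

Section velocity_estimates.
Context {R : realType} {n : nat}.
Local Notation V := 'rV[R]_n.+1.
Local Notation N := (@ord_max n).

Lemma le_sqrt_norm (y S : R) : y ^+ 2 <= S -> `|y| <= Num.sqrt S.
Proof.
by move=> yS; rewrite -sqrtr_sqr ler_sqrt// (le_trans _ yS)// sqr_ge0.
Qed.

Lemma le_sum_term (f : 'I_n.+1 -> R) i : (forall j, 0 <= f j) ->
  f i <= \sum_j f j.
Proof. by move=> f0; rewrite (bigD1 i)//= lerDl sumr_ge0. Qed.

Lemma component_le_euclidean_norm (x : V) j : `|x 0 j| <= euclidean_norm x.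
Proof.
apply: le_sqrt_norm; apply: (@le_sum_term (fun i => x 0 i ^+ 2)) => i.
exact: sqr_ge0.
Qed.

Lemma component_le_tangential (x : V) j : j != N ->
  `|x 0 j| <= euclidean_norm (tangential x).
Proof.
move=> jN; have := component_le_euclidean_norm (tangential x) j.
by rewrite mxE (negbTE jN).
Qed.

Variable v : V -> V.

Lemma partial_le_grad_norm (x : V) k j :
  `|partial k (component v j) x| <= grad_norm v x.
Proof.
apply: le_sqrt_norm.
apply: le_trans (@le_sum_term
  (fun j => \sum_k partial k (component v j) x ^+ 2) j _).
  apply: (@le_sum_term (fun k => partial k (component v j) x ^+ 2)) => l.
  exact: sqr_ge0.
by move=> l; apply: sumr_ge0 => m _; exact: sqr_ge0.
Qed.

Lemma partial2_le_hessian_norm (x : V) i k j :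
  `|partial i (partial k (component v j)) x| <= hessian_norm v x.
Proof.
apply: le_sqrt_norm.
apply: le_trans (@le_sum_term (fun i => \sum_j \sum_k
  partial i (partial k (component v j)) x ^+ 2) i _); last first.
  move=> l; apply: sumr_ge0 => m _; apply: sumr_ge0 => p _; exact: sqr_ge0.
apply: le_trans (@le_sum_term (fun j => \sum_k
  partial i (partial k (component v j)) x ^+ 2) j _); last first.
  by move=> l; apply: sumr_ge0 => m _; exact: sqr_ge0.
apply: (@le_sum_term (fun k => partial i (partial k (component v j)) x ^+ 2)) => l.
exact: sqr_ge0.
Qed.

Lemma grad_norm_sqr (x : V) :
  \sum_j \sum_k partial k (component v j) x * partial k (component v j) x =
  grad_norm v x ^+ 2.
Proof.
rewrite sqr_sqrtr; first by [].
by apply: sumr_ge0 => j _; apply: sumr_ge0 => k _; exact: sqr_ge0.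
Qed.

Definition tangential_density (x : V) : R :=
  euclidean_norm (tangential (v x)) * grad_norm v x * hessian_norm v x.

Lemma tangential_density_ge0 (x : V) : 0 <= tangential_density x.
Proof. by rewrite /tangential_density !mulr_ge0 ?sqrtr_ge0. Qed.

Hypothesis regular : C2_C1bar v.
Hypothesis slip : slip_boundary_condition v.
Hypothesis divergence_free : forall x, half_space x -> divergence v x = 0.

Lemma tangential_density_continuous (x : V) : half_space x ->
  {for x, continuous tangential_density}.
Proof.
move=> x0; have cs := @sqrt_continuous R.
have cv j := @velocity_continuous R n v regular x j x0.
have ca k j := @gradient_continuous R n v regular x k j x0.
have cb l k j := @hessian_continuous R n v regular x l k j x0.
apply: continuous_atM; first apply: continuous_atM.
- apply: (@continuous_at_comp _ _ Num.sqrt) => //; apply: continuous_at_sum => j _.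
  rewrite (_ : (fun y => _) = (fun y => (if j == N then 0 else v y 0 j) *
    (if j == N then 0 else v y 0 j))); last first.
    by apply/funext => y; rewrite mxE expr2.
  by case: (j == N); [apply: continuous_atM; exact: continuous_at_cst|exact: continuous_atM].
- apply: (@continuous_at_comp _ _ Num.sqrt) => //; apply: continuous_at_sum => j _.
  by apply: continuous_at_sum => k _; exact: continuous_atM.
- apply: (@continuous_at_comp _ _ Num.sqrt) => //; apply: continuous_at_sum => i _.
  by apply: continuous_at_sum => j _; apply: continuous_at_sum => k _; exact: continuous_atM.
Qed.

Lemma flux_field_bound i (x : V) : `|flux_field v i x| <=
  (1 + n.+1%:R ^+ 2 + 2 * n.+1%:R) *
    (euclidean_norm (v x) * grad_norm v x ^+ 2).
Proof.
apply: flux_component_le.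
- by move=> k j; exact: partial_le_grad_norm.
- exact: sqrtr_ge0.
- by move=> j; exact: component_le_euclidean_norm.
- exact: grad_norm_sqr.
Qed.

Definition error_constant : R := n.+1%:R * (2 * n.+1%:R ^+ 2 + 4 * n.+1%:R).

Lemma error_constant_gt0 : 0 < error_constant.
Proof. by rewrite mulr_gt0// addr_gt0// mulr_gt0// exprn_gt0. Qed.

Lemma flux_field_error_bound (x : V) :
  `|flux_field_error v x| <= error_constant * tangential_density x.
Proof.
apply: (le_trans (ler_norm_sum _ _ _)).
rewrite /error_constant -mulrA mulr_natl -[X in _ *+ X]card_ord -sumr_const.
apply: ler_sum => i _; apply: flux_error_le.
- exact: sqrtr_ge0.
- by move=> j; exact: component_le_tangential.
- by move=> k j; exact: partial_le_grad_norm.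
- by move=> l k j; exact: partial2_le_hessian_norm.
Qed.

(** The derivatives are replaced by their continuous extensions, which coincide
    with them in the open half-space and satisfy the slip condition on the
    boundary. *)
Lemma flux_field_small (r delta : R) : 0 < r -> 0 < delta ->
  exists2 eps : R, 0 < eps & forall x : V, (forall k, `|x 0 k| <= r) ->
    0 < x 0 N <= 2 * eps -> `|flux_field v N x| <= delta.
Proof.
move=> r0 delta0.
have [D DP] : {D : 'I_n.+1 -> 'I_n.+1 -> V -> R | forall k j,
    {within closed_half_space, continuous (D k j)} /\
    forall x, half_space x -> D k j x = partial k (component v j) x}.
  exists (fun k j => sval (cid (c1_extension regular j k))) => k j.
  by case: cid.
have cD k j := (DP k j).1; have DE k j := (DP k j).2.
have cv j := within_component regular (j := j).
have [| |eps eps0 small] := @small_near_boundary R n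
    (fun x => flux_component (v x 0) (fun k j => D k j x) N) r delta _ _ r0 delta0.
- apply: withinD; last first.
    apply: (within_comp (p := fun y : R => - y)); first exact: opp_continuous.
    apply: withinM; first exact: within_cst.
    by apply: withinM; [exact: cv|apply: within_sum => k _; exact: withinM].
  apply: withinD; last first.
    apply: within_sum => l _; apply: withinM; first exact: cv.
    exact: withinM.
  apply: withinD; last first.
    apply: within_sum => j _; apply: within_sum => k _.
    by apply: withinM; [exact: cv|exact: withinM].
  apply: withinM; first exact: within_cst.
  apply: withinM; first exact: cv.
  by apply: within_sum => j _; apply: within_sum => k _; exact: withinM.
- move=> x x0; apply: flux_component_boundary.
  + exact: (slip x0).1.
  + move=> k kN.
    exact: (tangential_derivative_boundary regular slip kN (cD k N) (DE k N) x0).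
  + move=> j jN.
    exact: (normal_derivative_boundary regular slip jN (cD N j) (DE N j) x0).
exists eps => // x xr /andP[x0 xe].
rewrite (_ : flux_field v N x =
  flux_component (v x 0) (fun k j => D k j x) N).
  by apply: small => //; rewrite x0.
by congr (flux_component _ _ _); apply/funext => k; apply/funext => j; rewrite DE.
Qed.

Hypothesis decay : half_space_integrable
  (fun x => euclidean_norm (v x) * grad_norm v x ^+ 2).
Hypothesis integrable_lhs : half_space_integrable (grad_convection_dot_grad v).

(** If the right-hand side is finite, the error term is integrable, and hence so
    is the divergence of the flux, which is the sum of the integrand and of the
    error; its integral is zero. *)
Lemma grad_convection_estimate :
  (`| half_space_integral (grad_convection_dot_grad v) | <=
   error_constant%:E * half_space_integral tangential_density)%E.
Proof.
have c0 := error_constant_gt0.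
have P0 : (0 <= half_space_integral tangential_density)%E.
  by apply: integral_ge0 => t _; rewrite lee_fin tangential_density_ge0.
have [->|Pfin] := eqVneq (half_space_integral tangential_density) +oo%E.
  by rewrite gt0_muley ?leey// lte_fin.
have iP : half_space_integrable tangential_density.
  apply/integrableP; split.
    by apply: measurable_half_space_fun => x; exact: tangential_density_continuous.
  rewrite (eq_integral (fun t => (tangential_density (row_of_tuple t))%:E)).
    by rewrite ltey.
  by move=> t _; rewrite gee0_abs// lee_fin tangential_density_ge0.
have iE : half_space_integrable (flux_field_error v).
  apply: half_space_integrable_le (half_space_integrableZ error_constant iP).
    by move=> x; exact: flux_field_error_continuous.
  by move=> x _; exact: flux_field_error_bound.
have G_integrable i : half_space_integrable (flux_field v i).
  apply: half_space_integrable_le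
    (half_space_integrableZ (1 + n.+1%:R ^+ 2 + 2 * n.+1%:R) decay).
    by move=> x; exact: flux_field_continuous.
  by move=> x _; exact: flux_field_bound.
have W_integrable : half_space_integrable (fun x => \sum_i partial i (flux_field v i) x).
  apply: eq_half_space_integrable (half_space_integrableD integrable_lhs iE).
  by move=> x x0; rewrite (grad_convection_divergence regular)// subrK.
have W0 : half_space_integral (fun x => \sum_i partial i (flux_field v i) x) = 0%E.
  apply: half_space_divergence => //.
  - by move=> i x x0; have [] := is_derive_flux_field regular i x0.
  - by move=> i x; exact: flux_field_continuous.
  - by move=> i x; exact: partial_flux_field_continuous.
  - exact: flux_field_small.
have L : half_space_integral (grad_convection_dot_grad v) =
    (- half_space_fine_integral (flux_field_error v))%:E.
  rewrite (eq_half_space_integral (grad_convection_divergence regular _))//.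
  rewrite half_space_integralE; last first.
    apply: eq_half_space_integrable integrable_lhs => x x0.
    by rewrite (grad_convection_divergence regular).
  congr (_%:E); rewrite -(add0r (- _)).
  rewrite (_ : (fun x => _) = (fun x => \sum_i partial i (flux_field v i) x
    + (-1) * flux_field_error v x)); last by apply/funext => x; rewrite mulN1r.
  rewrite half_space_integralD//; last exact: half_space_integrableZ.
  rewrite half_space_integralZ// mulN1r; congr (_ + _).
  by rewrite /half_space_fine_integral W0.
rewrite L (half_space_integralE iP) -EFinM lee_fin normrN.
rewrite -half_space_integralZ//; apply: half_space_integral_norm_le => //.
  exact: half_space_integrableZ.
by move=> x _; exact: flux_field_error_bound.
Qed.

End velocity_estimates.

(* The dimension is n.+1 >= 3. The last two hypotheses on u t say that the
   velocity decays at infinity enough for the integration by parts, and that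
   the integral on the left-hand side exists. *)
Theorem mainTheorem2 (R : realType) (n : nat) (hn : (3 <= n.+1)%N) :
  exists c : R, 0 < c /\
    forall (mu T : R) (u0 : 'rV[R]_n.+1 -> 'rV[R]_n.+1)
      (u : R -> 'rV[R]_n.+1 -> 'rV[R]_n.+1) (p : R -> 'rV[R]_n.+1 -> R),
    0 < mu -> 0 < T ->
    navier_stokes_solution mu T u0 u p ->
    (forall t : R, 0 < t <= T -> slip_boundary_condition (u t)) ->
    forall t : R, 0 < t <= T ->
    half_space_integrable
      (fun x => euclidean_norm (u t x) * grad_norm (u t) x ^+ 2) ->
    half_space_integrable (grad_convection_dot_grad (u t)) ->
    (`| half_space_integral (grad_convection_dot_grad (u t)) | <=
     c%:E * half_space_integral (fun x =>
       (euclidean_norm (tangential (u t x)) * grad_norm (u t) x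
          * hessian_norm (u t) x)%R))%E.
Proof.
exists (@error_constant R n); split; first exact: error_constant_gt0.
move=> mu T u0 u p _ _ ns slip t tT decay lhs.
apply: grad_convection_estimate => //.
- exact: (ns_velocity_space ns tT).
- exact: slip.
- by move=> x x0; exact: (ns_incompressible ns tT x0).
Qed.
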